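(* The following identities hold (as formal power series in $x$ with coefficients in $\mathbb{Z}[q]$): \begin{align*} \sum_{n\ge0} \hat{\chi}_{A_n}(q)\, x^n&=\frac{\sum_{n\ge0} (-1)^n q^{\binom{n+1}2} x^n}{\sum_{n\ge0} (-1)^n q^{\binom{n}2} x^n},\\ \sum_{n\ge0} \hat{\chi}_{B_n}(q)\, x^n&=\frac{\sum_{n\ge0} (-1)^n q^{n^2} x^n}{\sum_{n\ge0} (-1)^n q^{\binom{n}2} x^n},\\ \sum_{n\ge2} \hat{\chi}_{D_n}(q)\, x^n&=\frac{\sum_{n\ge2} (-1)^n \left(q^{\binom{n-1}2}-2q^{\binom{n}2}+q^{2\binom{n}2}\right) x^n}{\sum_{n\ge0} (-1)^n q^{\binom{n}2} x^n}. \end{align*}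
   Context: For a Coxeter group $W$ with Coxeter generators $S$, $\ell(w)$ is the minimal number of generators in an expression of $w$. $W$ is ordered by the (left) weak order: $u\le w$ if $w=s_k\cdots s_1u$ for some $s_j\in S$ with $\ell(s_j\cdots s_1u)=\ell(u)+j$ for $0\le j\le k$. The bottom element is the identity $e$ and the rank of $w$ is $\ell(w)$. Let $\mu_W$ be the Möbius function of this poset, defined by $\sum_{x\le t\le y}\mu_W(x,t)=\delta_{x,y}$ for all $x\le y$. The modified characteristic polynomial is \[\hat\chi_W(q)=\sum_{w\in W}\mu_W(e,w)\,q^{\ell(w)}.\] $A_n$, $B_n$, $D_n$ are the finite classical Coxeter groups of rank $n$. The Coxeter graph of $A_n$ is a path on $n$ vertices with unlabeled edges; that of $B_n$ is a path on $n$ vertices with one end edge labeled $4$; that of $D_n$ is a path on vertices $1,\dots,n-1$ with an additional vertex $n$ adjacent only to $n-2$. Conventions: $B_1\cong A_1$, $D_2\cong A_1\times A_1$, $D_3\cong A_3$, and $\hat\chi_{A_0}(q)=\hat\chi_{B_0}(q)=1$ (trivial group). *)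

(* Defs.v *)
From HB Require Import structures.
From mathcomp Require Import all_boot all_order all_fingroup all_algebra.

Set Implicit Arguments.
Unset Strict Implicit.
Unset Printing Implicit Defensive.

Import Order.TTheory GRing.Theory.

Section CoxeterSystems.

Local Open Scope group_scope.

(* An entry [m i j = 0] stands for an infinite label: [x ^+ 0 = 1] imposes no
   relation. *)
Definition coxeter_matrix (I : finType) (m : I -> I -> nat) : Prop :=
  [/\ forall i, m i i = 1%N,
      forall i j, m i j = m j i
    & forall i j, i != j -> m i j <> 1%N].

Definition coxeter_relations (I : finType) (m : I -> I -> nat)
    (G : groupType) (s : I -> G) : Prop :=
  forall i j, (s i * s j) ^+ m i j = 1.

(* The last three fields say that [cox_group] is the group presented by the
   generators [s_i] and the relations [(s_i s_j)^(m i j) = 1]. *)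
Record finCoxeterSystem (I : finType) (m : I -> I -> nat) := FinCoxeterSystem {
  cox_group :> finGroupType;
  cox_gen : I -> cox_group;
  cox_matrix : coxeter_matrix m;
  cox_rel : coxeter_relations m cox_gen;
  cox_generated : forall w, exists t : seq I, w = \prod_(i <- t) cox_gen i;
  cox_universal : forall (G : groupType) (s : I -> G),
    coxeter_relations m s ->
    exists f : {multiplicative cox_group -> G}, forall i, f (cox_gen i) = s i
}.

Section Length.

Variables (I : finType) (m : I -> I -> nat) (W : finCoxeterSystem m).
Implicit Types u v w : W.

Local Notation s := (cox_gen W).

Lemma cox_expression_ex w :
  exists k, [exists t : k.-tuple I, w == \prod_(i <- t) s i].
Proof.
have [t def_w] := cox_generated w; exists (size t).
by apply/existsP; exists (in_tuple t); rewrite {1}def_w.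
Qed.

Definition cox_length w : nat := ex_minn (cox_expression_ex w).

Lemma cox_lengthP w : exists2 t, w = \prod_(i <- t) s i & size t = cox_length w.
Proof.
rewrite /cox_length; case: ex_minnP => k /existsP[t /eqP def_w] _.
by exists t => //; rewrite size_tuple.
Qed.

Lemma cox_length_le t : cox_length (\prod_(i <- t) s i) <= size t.
Proof.
rewrite /cox_length; case: ex_minnP => k _; apply.
by apply/existsP; exists (in_tuple t).
Qed.

Definition weak_step u v : bool :=
  [exists i, (v == s i * u) && (cox_length v == (cox_length u).+1)].

Definition weak_le u w : bool := connect weak_step u w.

Lemma weak_leP u w :
  reflect
    (exists2 t : seq I, w = \prod_(i <- rev t) s i * u
      & forall j, j <= size t ->
          cox_length (\prod_(i <- rev (take j t)) s i * u) = cox_length u + j)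
    (weak_le u w).
Proof.
apply: (iffP connectP) => [[p] | [t ->]].
  elim: p u => [|v p IHp] u /=.
    move=> _ ->; exists [::]; first by rewrite big_nil mul1g.
    by case=> // _; rewrite big_nil mul1g addn0.
  case/andP=> /existsP[i /andP[/eqP-> /eqP len_v]] /IHp{}IHp /IHp[t -> len_t].
  exists (i :: t); first by rewrite rev_cons -cats1 big_cat big_seq1 mulgA.
  case=> [|j] /=; first by rewrite big_nil mul1g addn0.
  rewrite ltnS => /len_t; rewrite len_v addSnnS => <-.
  by rewrite rev_cons -cats1 big_cat big_seq1 mulgA.
elim: t u => [|i t IHt] u len_t.
  by exists [::]; rewrite //= big_nil mul1g.
have len_iu: cox_length (s i * u) = (cox_length u).+1.
  by have:= len_t 1%N isT; rewrite /= take0 big_seq1 addn1.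
have [|p ep def_w] := IHt (s i * u).
  move=> j le_j_t; rewrite len_iu addSnnS -(len_t j.+1) //=.
  by rewrite rev_cons -cats1 big_cat big_seq1 mulgA.
exists (s i * u :: p) => /=.
  by rewrite ep andbT; apply/existsP; exists i; rewrite eqxx len_iu eqxx.
by rewrite -def_w rev_cons -cats1 big_cat big_seq1 mulgA.
Qed.

Lemma weak_le_length u w :
  weak_le u w -> cox_length u <= cox_length w ?= iff (u == w).
Proof.
case/weak_leP=> t def_w /(_ _ (leqnn _)); rewrite take_size -def_w => len_w.
split; first by rewrite len_w leq_addr.
apply/eqP/eqP=> [|->//]; rewrite len_w -{1}[cox_length u]addn0.
move/eqP; rewrite eqn_add2l eq_sym size_eq0 => /eqP t0.
by rewrite def_w t0 big_nil mul1g.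
Qed.

Lemma weak_le_refl : reflexive weak_le. Proof. exact: connect0. Qed.

Lemma weak_le_trans : transitive weak_le. Proof. exact: connect_trans. Qed.

Lemma weak_le_anti : antisymmetric weak_le.
Proof.
move=> u v /andP[/weak_le_length[le_uv eq_uv] /weak_le_length[le_vu _]].
by apply/eqP; rewrite -eq_uv eqn_leq le_uv.
Qed.

End Length.

End CoxeterSystems.

Fact weak_display : Order.disp_t. Proof. by []. Qed.

(* The elements of [W], carrying the left weak order. *)
Definition weakOrder (I : finType) (m : I -> I -> nat)
  (W : finCoxeterSystem m) : Type := W.

Section WeakOrder.

Variables (I : finType) (m : I -> I -> nat) (W : finCoxeterSystem m).

HB.instance Definition _ := Finite.copy (weakOrder W) (cox_group W).

HB.instance Definition _ :=
  Order.Le_isPOrder.Build weak_display (weakOrder W)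
    (@weak_le_refl I m W) (@weak_le_anti I m W) (@weak_le_trans I m W).

End WeakOrder.

Local Open Scope ring_scope.

Section Mobius.

Variables (d : Order.disp_t) (T : finPOrderType d).
Implicit Types x y t : T.

(* The recursion mu(x, y) = delta_{x, y} - sum_(x <= t < y) mu(x, t), run with
   [k] units of fuel; chains of T have at most #|T| elements. *)
Fixpoint mobius_rec (k : nat) x y : int :=
  if k is k'.+1 then
    (x == y)%:R - \sum_(t | (x <= t < y)%O) mobius_rec k' x t
  else 0.

Definition mobius x y : int := mobius_rec #|T| x y.

Lemma card_down_gt0 y : (0 < #|[set t | (t <= y)%O]|)%N.
Proof. by apply/card_gt0P; exists y; rewrite inE. Qed.

Lemma mobius_rec_stable k x y :
  (#|[set t | (t <= y)%O]| <= k)%N -> mobius_rec k x y = mobius x y.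
Proof.
suff stable k1 k2 z: (#|[set t | (t <= z)%O]| <= k1)%N ->
    (#|[set t | (t <= z)%O]| <= k2)%N -> mobius_rec k1 x z = mobius_rec k2 x z.
  by move=> le_k; apply: stable => //; apply: max_card.
elim: k1 k2 z => [|k1 IHk] [|k2] z //.
- by rewrite leqNgt (card_down_gt0 z).
- by move=> _; rewrite leqNgt (card_down_gt0 z).
move=> le1 le2 /=; congr (_ - _); apply: eq_bigr => t /andP[_ lt_tz].
suff lt_card: (#|[set u | (u <= t)%O]| < #|[set u | (u <= z)%O]|)%N.
  by apply: IHk; rewrite -ltnS; apply: leq_trans lt_card _.
apply: proper_card; apply/properP; split.
  by apply/subsetP=> u; rewrite !inE => /le_trans; apply; apply: ltW.
by exists z; rewrite !inE ?lexx //; apply/negP=> /(lt_le_trans lt_tz); rewrite ltxx.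
Qed.

Lemma mobiusE x y :
  mobius x y = (x == y)%:R - \sum_(t | (x <= t < y)%O) mobius x t.
Proof.
have le_y: (#|[set t | (t <= y)%O]| <= #|T|.+1)%N by rewrite leqW ?max_card.
by rewrite -(mobius_rec_stable x le_y).
Qed.

Lemma sum_mobius x y : (x <= y)%O ->
  \sum_(t | (x <= t <= y)%O) mobius x t = (x == y)%:R.
Proof.
move=> le_xy; rewrite (bigD1 y) ?le_xy ?lexx //= mobiusE.
rewrite [X in _ - _ + X](eq_bigl (fun t => (x <= t < y)%O)) ?subrK // => t.
by rewrite lt_neqAle andbC [in RHS]andbCA.
Qed.

End Mobius.

Definition mod_charpoly (I : finType) (m : I -> I -> nat)
    (W : finCoxeterSystem m) : {poly int} :=
  \sum_(w : weakOrder W) @mobius _ (weakOrder W) (1%g : W) w *: 'X^(cox_length w).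

Section ClassicalTypes.

Variable n : nat.
Implicit Types i j : 'I_n.

Definition path_edge i j : bool := (j == i.+1 :> nat) || (i == j.+1 :> nat).

Lemma path_edgeC i j : path_edge i j = path_edge j i.
Proof. exact: orbC. Qed.

Definition coxA i j : nat :=
  if i == j then 1 else if path_edge i j then 3 else 2.

Definition coxB i j : nat :=
  if i == j then 1 else
  if path_edge i j then
    if (i == 0 :> nat) || (j == 0 :> nat) then 4 else 3
  else 2.

(* Vertices 1, ..., n are numbered from 0 here: 0, ..., n - 2 form a path and
   n - 1 is adjacent to n - 3 only (to nothing when n = 2). *)
Definition forkD i j : bool := (i.+3 == n) && (j.+1 == n).

Definition edgeD i j : bool :=
  [|| [&& path_edge i j, i.+1 < n & j.+1 < n]%N, forkD i j | forkD j i].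

Definition coxD i j : nat :=
  if i == j then 1 else if edgeD i j then 3 else 2.

Lemma coxA_matrix : coxeter_matrix coxA.
Proof.
split=> [i|i j|i j neq_ij]; rewrite /coxA ?eqxx //.
  by rewrite eq_sym path_edgeC.
by rewrite (negPf neq_ij); case: ifP.
Qed.

Lemma coxB_matrix : coxeter_matrix coxB.
Proof.
split=> [i|i j|i j neq_ij]; rewrite /coxB ?eqxx //.
  by rewrite eq_sym path_edgeC orbC.
by rewrite (negPf neq_ij); case: ifP => // _; case: ifP.
Qed.

Lemma coxD_matrix : coxeter_matrix coxD.
Proof.
split=> [i|i j|i j neq_ij]; rewrite /coxD ?eqxx //.
  by rewrite eq_sym /edgeD path_edgeC [forkD i j || _]orbC [(i.+1 < n)%N && _]andbC.
by rewrite (negPf neq_ij); case: ifP.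
Qed.

End ClassicalTypes.

Section PowerSeries.

Variable R : comUnitRingType.

(* The series sum_n (F n) x^n; equality of series is [=1]. *)
Definition fps : Type := nat -> R.
Implicit Types F N D : fps.

Definition fps_mul F D : fps := fun n => \sum_(k < n.+1) F k * D (n - k)%N.

(* The first [n] coefficients of N / D, by long division. *)
Fixpoint fps_div_prefix N D (n : nat) : seq R :=
  if n is n'.+1 then
    let c := fps_div_prefix N D n' in
    rcons c ((N n' - \sum_(k < n') c`_k * D (n' - k)%N) / D 0)
  else [::].

(* Meaningful when [D 0] is a unit. *)
Definition fps_div N D : fps := fun n => (fps_div_prefix N D n.+1)`_n.

Lemma size_fps_div_prefix N D n : size (fps_div_prefix N D n) = n.
Proof. by elim: n => //= n IHn; rewrite size_rcons IHn. Qed.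

Lemma nth_fps_div_prefix N D n k : (k < n)%N ->
  (fps_div_prefix N D n)`_k = fps_div N D k.
Proof.
elim: n => // n IHn; rewrite ltnS leq_eqVlt => /predU1P[-> // | lt_kn].
by rewrite /= nth_rcons size_fps_div_prefix lt_kn IHn.
Qed.

Lemma fps_div_rec N D n :
  fps_div N D n = (N n - \sum_(k < n) fps_div N D k * D (n - k)%N) / D 0.
Proof.
rewrite {1}/fps_div /= nth_rcons size_fps_div_prefix ltnn eqxx.
by congr ((_ - _) / _); apply: eq_bigr => k _; rewrite nth_fps_div_prefix.
Qed.

Lemma fps_divP F N D : D 0 \is a GRing.unit ->
  F =1 fps_div N D <-> fps_mul F D =1 N.
Proof.
move=> uD; split=> [eqF n | eqN].
  rewrite /fps_mul big_ord_recr /= subnn eqF fps_div_rec divrK // addrC.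
  by rewrite [X in _ + X](eq_bigr (fun k : 'I_n => fps_div N D k * D (n - k)%N))
     ?subrK // => k _; rewrite eqF.
move=> n; have [b] := ubnP n; elim: b n => // b IHb n lt_nb.
apply: (mulIr uD); rewrite fps_div_rec divrK // -eqN /fps_mul big_ord_recr /=.
rewrite subnn [X in X + _ - _](eq_bigr
  (fun k : 'I_n => fps_div N D k * D (n - k)%N)) ?[_ + F n * _]addrC ?addrK //.
by move=> k _; rewrite IHb //; apply: leq_trans (ltn_ord k) _.
Qed.

End PowerSeries.

(* Main.v *)
Require Import Defs.
From HB Require Import structures.
From mathcomp Require Import all_boot all_order all_fingroup all_algebra.
From mathcomp Require Import ring zify.

Set Implicit Arguments.
Unset Strict Implicit.
Unset Printing Implicit Defensive.

Import Order.TTheory GRing.Theory Num.Theory.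

Local Open Scope ring_scope.

(** The Moebius function of the weak order is supported on longest elements of
    parabolic subgroups. Write [w0 J] for the longest element of the subgroup
    generated by the reflections in a set [J] of vertices. In the left weak
    order, [w0 J <= w] holds exactly when every [i] in [J] is a right descent
    of [w] ([longest_le]), so the sum of [(-1)^|J|] over all [J] with
    [w0 J <= w] is an alternating sum over the subsets of the descent set of
    [w]. That sum vanishes unless [w = 1]. This is the defining recursion of
    the Moebius function, hence [mu(1, w)] is the sum of [(-1)^|J|] over the
    [J] with [w0 J = w], and the modified characteristic polynomial is the sum
    over [J] of [(-1)^|J| q^(l (w0 J))].

    The descent criterion and the lengths both come from the integral geometric
    representation attached to a Cartan matrix. Its key property is that [w]
    sends the simple root [a_i] to a nonnegative vector as soon as
    [l (w s_i) > l w] ([ascent_nonneg]). Given a finite list of vectors that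
    behaves like a set of positive roots, the length of [w] is then the number
    of roots made negative by [w], and the length of [w0 J] is the number of
    roots supported in [J] ([mod_charpoly_roots]).

    What remains is to list the roots and to sum over [J]. In all three types
    the vertices can be numbered so that the diagram grows by adding a vertex
    to the end of a path. Sort the subsets [J] by their topmost missing vertex
    [n]: the vertices above [n] form a path of type A, with [C(r + 1, 2)]
    positive roots if there are [r] of them, and the rest of [J] is an
    arbitrary subset of the smaller diagram on [0, ..., n - 1]. Up to a shift of
    [r] by one, this is a convolution with the denominator, whose coefficients
    are the [(-1)^r q^C(r, 2)], and the numerator collects the subsets without
    such a gap ([subset_poly_recursion]). In types A and B only the full vertex
    set is left; in type D the smaller diagram must keep the two vertices of the
    fork, so the four subsets of these two contribute the three terms of the
    numerator, the middle one twice. *)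

(** * The geometric representation *)

(** Invertible integer matrices, as targets for the universal property of a
    Coxeter group. Storing the inverse next to the matrix makes the group axioms
    immediate in every dimension, including 0. *)
Definition int_gl (n : nat) : Type :=
  {p : 'M[int]_n * 'M[int]_n | (p.1 *m p.2 == 1%:M) && (p.2 *m p.1 == 1%:M)}.

Section IntGL.

Variable n : nat.
Implicit Types g h : int_gl n.

HB.instance Definition _ := Choice.on (int_gl n).

Fact int_gl1_proof :
  (1%:M *m 1%:M == 1%:M :> 'M[int]_n) && (1%:M *m 1%:M == 1%:M :> 'M[int]_n).
Proof. by rewrite mulmx1 eqxx. Qed.

Definition int_gl1 : int_gl n := Sub (1%:M, 1%:M) int_gl1_proof.

Fact int_glV_proof g :
  ((val g).2 *m (val g).1 == 1%:M) && ((val g).1 *m (val g).2 == 1%:M).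
Proof. by case: g => p /= /andP[-> ->]. Qed.

Definition int_glV g : int_gl n :=
  Sub ((val g).2, (val g).1) (int_glV_proof g).

Fact int_glM_proof g h :
  ((val g).1 *m (val h).1 *m ((val h).2 *m (val g).2) == 1%:M) &&
  ((val h).2 *m (val g).2 *m ((val g).1 *m (val h).1) == 1%:M).
Proof.
case: g h => [[a b] /= /andP[/eqP ab /eqP ba]] [[c d] /= /andP[/eqP cd /eqP dc]].
by rewrite !mulmxA -(mulmxA a) -(mulmxA d) cd ba !mulmx1 ab dc eqxx.
Qed.

Definition int_glM g h : int_gl n :=
  Sub ((val g).1 *m (val h).1, (val h).2 *m (val g).2) (int_glM_proof g h).

Fact int_glMA : associative int_glM.
Proof. by move=> g h k; apply: val_inj; rewrite /= !mulmxA. Qed.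

Fact int_gl1M : left_id int_gl1 int_glM.
Proof. by move=> g; apply: val_inj; rewrite /= mul1mx mulmx1; case: (\val g). Qed.

Fact int_glM1 : right_id int_gl1 int_glM.
Proof. by move=> g; apply: val_inj; rewrite /= mul1mx mulmx1; case: (\val g). Qed.

Fact int_glVM : left_inverse int_gl1 int_glV int_glM.
Proof. by case=> p Hp; apply: val_inj => /=; case/andP: Hp => _ /eqP->. Qed.

Fact int_glMV : right_inverse int_gl1 int_glV int_glM.
Proof. by case=> p Hp; apply: val_inj => /=; case/andP: Hp => /eqP->. Qed.

HB.instance Definition _ := isGroup.Build (int_gl n)
  int_glMA int_gl1M int_glM1 int_glVM int_glMV.

End IntGL.

(** [C i j] is the pairing of the coroot of [i] with the simple root [j]. The
    product of [C i j] and [C j i] is [0], [1] or [2] according to the label of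
    the edge, which is [4 cos^2 (pi / m i j)]; in the last case the two possible
    choices say which of the two simple roots is the short one. *)
Definition cartan_for (n : nat) (m : 'I_n -> 'I_n -> nat)
    (C : 'I_n -> 'I_n -> int) : Prop :=
  (forall i, C i i = 2) /\
  (forall i j, i != j ->
     [\/ m i j = 2%N /\ (C i j = 0 /\ C j i = 0),
         m i j = 3%N /\ (C i j = -1 /\ C j i = -1),
         m i j = 4%N /\ (C i j = -1 /\ C j i = -2)
       | m i j = 4%N /\ (C i j = -2 /\ C j i = -1)]).

Section Reflections.

Variables (n : nat) (C : 'I_n -> 'I_n -> int).
Implicit Types (i j k : 'I_n) (v u : 'cV[int]_n).

Definition simple_root i : 'cV[int]_n := delta_mx i 0.

Local Notation a := simple_root.

Definition coroot i v : int := \sum_j C i j * v j 0.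

Definition refl_mx i : 'M[int]_n := 1%:M - a i *m \row_j C i j.

Lemma refl_mxE i v : refl_mx i *m v = v - coroot i v *: a i.
Proof.
rewrite mulmxBl mul1mx -mulmxA; congr (_ - _).
apply/matrixP=> k z; rewrite !ord1 !mxE big_ord1 !mxE mulrC; congr (_ * _).
by apply: eq_bigr => j _; rewrite !mxE.
Qed.

Lemma corootD i v u : coroot i (v + u) = coroot i v + coroot i u.
Proof. by rewrite -big_split; apply: eq_bigr => j _; rewrite mxE mulrDr. Qed.

Lemma corootZ i c v : coroot i (c *: v) = c * coroot i v.
Proof.
by rewrite /coroot mulr_sumr; apply: eq_bigr => j _; rewrite mxE mulrCA.
Qed.

Lemma coroot_simple i j : coroot i (a j) = C i j.
Proof.
rewrite /coroot (bigD1 j) //= big1 ?mxE ?eqxx ?mulr1 ?addr0 // => k neq_kj.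
by rewrite mxE (negPf neq_kj) mulr0.
Qed.

Hypothesis C2 : forall i, C i i = 2.

Lemma refl_mx_simple i : refl_mx i *m a i = - a i.
Proof. by rewrite refl_mxE coroot_simple C2 scaler_nat mulr2n opprD addNKr. Qed.

Lemma mulmx_id (A : 'M[int]_n) : (forall v : 'cV_n, A *m v = v) -> A = 1%:M.
Proof.
move=> A_id; apply/matrixP=> k j; have := A_id (delta_mx j 0).
by rewrite -colE => /matrixP/(_ k 0); rewrite !mxE andbT eq_sym => ->.
Qed.

Lemma refl_mxK i : refl_mx i *m refl_mx i = 1%:M.
Proof.
apply: mulmx_id => v; rewrite -mulmxA !refl_mxE corootD -scaleNr corootZ.
rewrite coroot_simple C2 [_ + _ * 2](_ : _ = - coroot i v); last by ring.
by rewrite !scaleNr opprK subrK.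
Qed.

Definition refl_gl i : int_gl n.
Proof. by exists (refl_mx i, refl_mx i); rewrite /= refl_mxK eqxx. Defined.

(** Words in two reflections move [v] only by multiples of their two simple
    roots, so that checking a braid relation reduces to arithmetic on the pair
    of coefficients [(x, y)]. *)
Lemma refl_plane i j v (x y p q : int) :
  coroot i v = p -> coroot j v = q ->
  (refl_mx i *m (v + (x *: a i + y *: a j)) =
     v + ((- x - p - C i j * y) *: a i + y *: a j)) *
  (refl_mx j *m (v + (x *: a i + y *: a j)) =
     v + (x *: a i + (- y - q - C j i * x) *: a j)).
Proof.
move=> <- <-; rewrite !refl_mxE !corootD !corootZ !coroot_simple !C2.
split; rewrite -addrA; congr (_ + _).
  rewrite addrAC -scaleNr -scalerDl; congr (_ *: _ + _); ring.
by rewrite -addrA -scaleNr -scalerDl; congr (_ + _ *: _); ring.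
Qed.

Lemma refl_gl_rel (m : 'I_n -> 'I_n -> nat) :
  (forall i, m i i = 1%N) -> cartan_for m C -> coxeter_relations m refl_gl.
Proof.
move=> m1 [_ mC] i j; apply: val_inj.
suff: (val ((refl_gl i * refl_gl j) ^+ m i j)%g).1 = 1%:M.
  move=> E; have := valP ((refl_gl i * refl_gl j) ^+ m i j)%g.
  case: (val _) E => b c /= ->; rewrite mul1mx mulmx1 => /andP[/eqP-> _] //.
apply: mulmx_id => v.
have [<-{j}|/mC mCij] := eqVneq i j.
  by rewrite m1 expg1 /= refl_mxK mul1mx.
have R x y := @refl_plane i j v x y _ _ erefl erefl.
have v0: v = v + (0 *: a i + 0 *: a j) by rewrite !scale0r !addr0.
rewrite [in LHS]v0 [RHS]v0.
(* Applying the word letter by letter brings both coefficients back to 0. *)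
by case: mCij => -[-> [E1 E2]]; rewrite !expgS expg0 /= mulmx1 -!mulmxA !R E1 E2;
  congr (_ + (_ *: _ + _ *: _)); ring.
Qed.

End Reflections.

(** * Length and descents *)

Section Braids.

Variables (G : groupType) (x y : G).
Hypotheses (x2 : (x * x = 1)%g) (y2 : (y * y = 1)%g).
Local Open Scope group_scope.

Let xV : x^-1 = x. Proof. by apply: (mulgI x); rewrite mulgV x2. Qed.
Let yV : y^-1 = y. Proof. by apply: (mulgI y); rewrite mulgV y2. Qed.

Lemma braid2 : (x * y) ^+ 2 = 1 -> x * y = y * x.
Proof. by rewrite expgS expg1 => /eqP; rewrite mulg_eq1 invMg xV yV => /eqP. Qed.

Lemma braid3 : (x * y) ^+ 3 = 1 -> x * y * x = y * x * y.
Proof.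
have ->: (x * y) ^+ 3 = x * y * x * (y * x * y).
  by rewrite !expgS expg0 mulg1 !mulgA.
by move/eqP; rewrite mulg_eq1 !invMg xV yV mulgA => /eqP.
Qed.

Lemma braid4 : (x * y) ^+ 4 = 1 -> x * y * x * y = y * x * y * x.
Proof.
rewrite -[4%N]/(2 + 2)%N expgD expgS expg1 => /eqP.
by rewrite mulg_eq1 !invMg xV yV !mulgA => /eqP.
Qed.

End Braids.

Section Descents.

Variables (I : finType) (m : I -> I -> nat) (W : finCoxeterSystem m).
Implicit Types (u v w : W) (i j : I).
Local Open Scope nat_scope.
Local Open Scope group_scope.
Local Notation s := (cox_gen W).
Local Notation l := (@cox_length I m W).

Lemma cox_gen2 i : s i * s i = 1.
Proof.
have [m1 _ _] := cox_matrix W.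
by have := cox_rel W i i; rewrite m1 expg1.
Qed.

Lemma mulg_genK i : involutive (fun w => w * s i).
Proof. by move=> w; rewrite -mulgA cox_gen2 mulg1. Qed.

Lemma cox_length1 : l 1 = 0%N.
Proof.
by have := cox_length_le W [::]; rewrite big_nil leqn0 => /eqP.
Qed.

Lemma cox_lengthM u v : l (u * v) <= l u + l v.
Proof.
have [t def_u <-] := cox_lengthP u; have [t' def_v <-] := cox_lengthP v.
by rewrite def_u def_v -big_cat -size_cat cox_length_le.
Qed.

Lemma cox_length_gen i : l (s i) <= 1.
Proof. by have := cox_length_le W [:: i]; rewrite big_seq1. Qed.

Lemma cox_length_mulgen w i : l (w * s i) <= (l w).+1.
Proof.
by apply: leq_trans (cox_lengthM _ _) _; rewrite -addn1 leq_add2l cox_length_gen.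
Qed.

Lemma cox_length_genmul w i : l (s i * w) <= (l w).+1.
Proof.
by apply: leq_trans (cox_lengthM _ _) _; rewrite -add1n leq_add2r cox_length_gen.
Qed.

(** The sign character, obtained from the universal property with the two
    element group of permutations of [bool] as target. *)
Lemma cox_length_parity w i : odd (l (w * s i)) = ~~ odd (l w).
Proof.
have [|f fE] := cox_universal W (G := {perm bool}) (s := fun=> tperm true false).
  move=> j k; rewrite [X in X ^+ _](_ : _ = 1) ?expg1n //; exact: tperm2.
have f1 : f 1 = 1 by apply: (mulgI (f 1)); rewrite -gmulfM !mulg1.
suff fl u : odd_perm (f u) = odd (l u).
  by rewrite -!fl gmulfM odd_permM fE odd_tperm addbT.
have [t def_u <-] := cox_lengthP u; rewrite def_u {def_u}.
elim: t => [|j t IHt]; first by rewrite big_nil f1 odd_perm1.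
by rewrite big_cons gmulfM odd_permM IHt fE odd_tperm.
Qed.

Definition descent w i : bool := l (w * s i) < l w.

Lemma descent_length w i : descent w i -> l w = (l (w * s i)).+1.
Proof.
rewrite /descent => lt_l; apply/eqP; rewrite eqn_leq lt_l andbT.
by have := cox_length_mulgen (w * s i) i; rewrite mulg_genK.
Qed.

Lemma ascent_length w i : ~~ descent w i -> l (w * s i) = (l w).+1.
Proof.
rewrite /descent -leqNgt => le_l; apply/eqP.
rewrite eqn_leq cox_length_mulgen ltn_neqAle le_l andbT; apply/eqP=> E.
by have := cox_length_parity w i; rewrite E; case: odd.
Qed.

Lemma descent_mulgen w i : descent (w * s i) i = ~~ descent w i.
Proof.
rewrite {1}/descent mulg_genK.
have [/descent_length->|/ascent_length->] := boolP (descent w i).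
  by rewrite ltnNge leqnSn.
by rewrite ltnSn.
Qed.

Lemma descent_ex w : w != 1 -> exists i, descent w i.
Proof.
have [t] := cox_lengthP w; case/lastP: t => [|t i] def_w size_t w_neq1.
  by rewrite def_w big_nil eqxx in w_neq1.
exists i; rewrite /descent -size_t size_rcons ltnS def_w -cats1 big_cat big_seq1.
by rewrite /= mulg_genK cox_length_le.
Qed.

Lemma cox_braid2 i j : m i j = 2 -> s i * s j = s j * s i.
Proof. by move=> mij; apply: braid2; rewrite ?cox_gen2 // -mij cox_rel. Qed.

Lemma cox_braid3 i j : m i j = 3 -> s i * s j * s i = s j * s i * s j.
Proof. by move=> mij; apply: braid3; rewrite ?cox_gen2 // -mij cox_rel. Qed.

Lemma cox_braid4 i j :
  m i j = 4 -> s i * s j * s i * s j = s j * s i * s j * s i.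
Proof. by move=> mij; apply: braid4; rewrite ?cox_gen2 // -mij cox_rel. Qed.

End Descents.

(** * The alternating sum over subsets *)

(** Expand the product of the factors [1 - [i in D]] over all [i]. *)
Lemma sum_sign_subset (T : finType) (D : {set T}) :
  \sum_(J : {set T} | J \subset D) (-1) ^+ #|J| = (D == set0)%:R :> int.
Proof.
have := bigA_distr (1 : int) +%R (fun i => - (i \in D)%:R) (fun=> 1 : int).
have -> : \prod_i (- (i \in D)%:R + 1) = (D == set0)%:R :> int.
  have [->|/set0Pn[i Di]] := eqVneq D set0.
    by rewrite big1 // => i _; rewrite inE oppr0 add0r.
  by rewrite (bigD1 i) //= Di addNr mul0r.
move->; rewrite big_mkcond; apply: eq_bigr => J _; rewrite -big_mkcond /=.
case: ifPn => [/subsetP JD|/subsetPn[i Ji D'i]].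
  by rewrite -prodr_const; apply: eq_bigr => i /JD->.
by rewrite (bigD1 i) //= (negPf D'i) oppr0 mul0r.
Qed.

(** * Roots and descents *)

Definition nonneg n (v : 'cV[int]_n) : Prop := forall k, 0 <= v k 0.

Lemma nonneg_comb n (u v : 'cV[int]_n) (x y : int) :
  0 <= x -> 0 <= y -> nonneg u -> nonneg v -> nonneg (x *: u + y *: v).
Proof.
by move=> x0 y0 u0 v0 k; rewrite !mxE addr_ge0 // mulr_ge0.
Qed.

Lemma simple_root_nonneg n (i : 'I_n) : nonneg (simple_root i).
Proof. by move=> k; rewrite mxE ler0n. Qed.

Section GeometricAction.

Variables (n : nat) (m : 'I_n -> 'I_n -> nat) (W : finCoxeterSystem m).
Variables (C : 'I_n -> 'I_n -> int) (act : W -> 'M[int]_n).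
Hypothesis mC : cartan_for m C.
Hypothesis act1 : act 1%g = 1%:M.
Hypothesis actM : forall u w, act (u * w)%g = act u *m act w.
Hypothesis act_gen : forall i, act (cox_gen W i) = refl_mx C i.

Implicit Types (u w : W) (v : 'cV[int]_n) (i j : 'I_n).
Local Notation s := (cox_gen W).
Local Notation l := (@cox_length _ m W).
Local Notation a := (@simple_root n).

Let C2 i : C i i = 2. Proof. by case: mC. Qed.

Lemma act_mulgen_simple w i : act (w * s i)%g *m a i = - (act w *m a i).
Proof. by rewrite actM act_gen -mulmxA refl_mx_simple // mulmxN. Qed.

Lemma act_plane u i j (x y : int) :
  act (u * s i)%g *m (x *: a i + y *: a j)
    = act u *m ((- x - C i j * y) *: a i + y *: a j).
Proof.
have := (@refl_plane n C C2 i j 0 x y 0 0).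
have coroot0 k : coroot C k 0 = 0.
  by rewrite /coroot big1 // => h _; rewrite mxE mulr0.
move=> /(_ (coroot0 _) (coroot0 _)) [+ _]; rewrite !add0r subr0 => E.
by rewrite actM act_gen -mulmxA E.
Qed.

Lemma act_plane' u i j (x y : int) :
  act (u * s j)%g *m (x *: a i + y *: a j)
    = act u *m (x *: a i + (- y - C j i * x) *: a j).
Proof. by rewrite addrC act_plane addrC. Qed.

(** Peel off the right end of [w] letters [s_j], [s_i], [s_j], ... alternately
    for as long as the length drops, where [s_j] is a descent of [w]. The rest
    [u] has neither [s_i] nor [s_j] as a descent, so that by induction it makes
    both simple roots nonnegative, and the letters removed send [a_i] to a
    nonnegative combination of [a_i] and [a_j]. The peeling has to stop before
    [m i j] letters: otherwise the braid relation would let [w] end in [s_i],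
    and [s_i] would be a descent of [w]. *)
Lemma ascent_nonneg w i : ~~ descent w i -> nonneg (act w *m a i).
Proof.
have [b] := ubnP (l w); elim: b w i => // b IHb w i; rewrite ltnS => le_w asc_i.
have IH u k : (l u < l w)%N -> ~~ descent u k -> nonneg (act u *m a k).
  by move=> lt_u; apply: IHb; apply: leq_trans lt_u le_w.
have [->|/descent_ex[j desc_j]] := eqVneq w 1%g.
  by rewrite act1 mul1mx; apply: simple_root_nonneg.
have neq_ij: i != j by apply: contraNneq asc_i => ->.
pose w1 := (w * s j)%g.
have def_w : w = (w1 * s j)%g by rewrite mulg_genK.
have l1 := descent_length desc_j; rewrite -/w1 in l1.
have asc1 : ~~ descent w1 j by rewrite descent_mulgen negbK.
clearbody w1.
have ok u x y : (l u < l w)%N -> ~~ descent u i -> ~~ descent u j ->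
    0 <= x -> 0 <= y -> nonneg (act u *m (x *: a i + y *: a j)).
  move=> lt_u ui uj x0 y0; rewrite mulmxDr -!scalemxAr.
  by apply: nonneg_comb => //; apply: IH.
(* A factorization of [w] that ends in [s_i] cannot be reduced. *)
have no_desc u t : w = (u * t * s i)%g -> (l u + l t < l w)%N -> False.
  move=> E lt_w; case/negP: asc_i; rewrite /descent {1}E mulg_genK.
  exact: leq_ltn_trans (cox_lengthM _ _) lt_w.
have l2 j1 j2 : (l (s j1 * s j2)%g <= 2)%N.
  by apply: leq_trans (cox_length_mulgen _ _) _; rewrite ltnS cox_length_gen.
have l3 j1 j2 j3 : (l (s j1 * s j2 * s j3)%g <= 3)%N.
  by apply: leq_trans (cox_length_mulgen _ _) _; rewrite ltnS l2.
have -> : a i = 1 *: a i + 0 *: a j by rewrite scale1r scale0r addr0.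
rewrite def_w act_plane'.
have [desc1|] := boolP (descent w1 i); last first.
  move=> asc1'; apply: ok; rewrite ?l1 //.
  by case: mC => _ /(_ i j neq_ij)[] [_ [E1 E2]]; rewrite ?E1 ?E2.
have ll1 := descent_length desc1; set w2 := (w1 * s i)%g in ll1 *.
have def_w1 : w1 = (w2 * s i)%g by rewrite mulg_genK.
have asc2 : ~~ descent w2 i by rewrite descent_mulgen negbK.
clearbody w2.
rewrite def_w1 act_plane.
case: mC => _ /(_ i j neq_ij) mCij.
have [mij|mij_neq2] := eqVneq (m i j) 2%N.
  case: (@no_desc w2 (s j)).
    by rewrite def_w def_w1 -!mulgA cox_braid2.
  by rewrite l1 ll1; have := cox_length_gen W j; lia.
have [desc2|asc2'] := boolP (descent w2 j); last first.
  apply: ok => //; first by rewrite l1 ll1; lia.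
    by case: mCij => -[mij [E1 E2]]; rewrite ?E1 ?E2 //; rewrite mij in mij_neq2.
  by case: mCij => -[mij [E1 E2]]; rewrite ?E1 ?E2 //; rewrite mij in mij_neq2.
have lll1 := descent_length desc2; set w3 := (w2 * s j)%g in lll1 *.
have def_w2 : w2 = (w3 * s j)%g by rewrite mulg_genK.
have asc3 : ~~ descent w3 j by rewrite descent_mulgen negbK.
clearbody w3.
rewrite def_w2 act_plane'.
have [mij|mij_neq3] := eqVneq (m i j) 3%N.
  case: (@no_desc w3 (s i * s j)%g).
    have := cox_braid3 W mij; rewrite -!mulgA => E.
    by rewrite def_w def_w1 def_w2 -!mulgA E.
  by rewrite l1 ll1 lll1; have := l2 i j; lia.
have {mCij}mCij : m i j = 4%N /\
    ((C i j = -1 /\ C j i = -2) \/ (C i j = -2 /\ C j i = -1)).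
  case: mCij => -[mij H]; split=> //; first [by left | by right
    | by rewrite mij in mij_neq2 | by rewrite mij in mij_neq3].
case: mCij => mij mCij.
have [desc3|asc3'] := boolP (descent w3 i); last first.
  apply: ok; rewrite ?l1 ?ll1 ?lll1 //; first lia.
    by case: mCij => -[E1 E2]; rewrite ?E1 ?E2.
  by case: mCij => -[E1 E2]; rewrite ?E1 ?E2.
have llll1 := descent_length desc3; set w4 := (w3 * s i)%g in llll1 *.
have def_w3 : w3 = (w4 * s i)%g by rewrite mulg_genK.
clearbody w4.
case: (@no_desc w4 (s j * s i * s j)%g).
  have := cox_braid4 W mij; rewrite -!mulgA => E.
  by rewrite def_w def_w1 def_w2 def_w3 -!mulgA E.
by rewrite l1 ll1 lll1 llll1; have := l3 j i j; lia.
Qed.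

(** * Longest elements of parabolic subgroups *)

Definition nonposb (v : 'cV[int]_n) : bool := [forall k, v k 0 <= 0].

Lemma nonposbP v : reflect (nonneg (- v)) (nonposb v).
Proof. by apply: (iffP forallP) => v0 k; have := v0 k; rewrite mxE oppr_ge0. Qed.

Lemma nonneg_nonposb v : nonneg v -> nonposb v -> v = 0.
Proof.
move=> v0 /forallP v0'; apply/matrixP=> k z; rewrite ord1 mxE.
by apply: le_anti; rewrite v0 v0'.
Qed.

Lemma simple_rootE i j : a i j 0 = (j == i)%:R.
Proof. by rewrite mxE andbT. Qed.

Lemma act_mulVg u v : act u^-1%g *m (act u *m v) = v.
Proof. by rewrite mulmxA -actM mulVg act1 mul1mx. Qed.

(** If [w a_i] were both nonnegative and nonpositive it would vanish, which is
    impossible for an invertible action. *)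
Lemma descentE w i : descent w i = nonposb (act w *m a i).
Proof.
have [desc|asc] := boolP (descent w i).
  have /ascent_nonneg : ~~ descent (w * s i)%g i by rewrite descent_mulgen negbK.
  by rewrite act_mulgen_simple => /nonposbP->.
apply/esym/negbTE/negP=> /(nonneg_nonposb (ascent_nonneg asc)) E.
have /matrixP/(_ i 0) := act_mulVg w (a i).
by rewrite E mulmx0 simple_rootE eqxx mxE.
Qed.

Lemma cV_simple_root (v : 'cV[int]_n) : v = \sum_i v i 0 *: a i.
Proof.
apply/matrixP=> k z; rewrite ord1 summxE (bigD1 k) //= mxE simple_rootE eqxx mulr1.
rewrite big1 ?addr0 // => i; rewrite mxE simple_rootE eq_sym => /negPf->.
by rewrite mulr0.
Qed.

Implicit Types (J : {set 'I_n}) (x y : W).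

Definition parabolic (J : {set 'I_n}) : {group W} := <<[set s i | i in J]>>%G.

Lemma parabolic_gen J i : i \in J -> s i \in parabolic J.
Proof. by move=> Ji; apply/mem_gen/imset_f. Qed.

(** A reflection changes only its own coordinate. *)
Lemma act_parabolic J w v j :
  w \in parabolic J -> j \notin J -> (act w *m v) j 0 = v j 0.
Proof.
move=> /gen_prodgP[k [c Jc ->]] J'j; elim/big_ind: _ v => [v|u1 u2 IH1 IH2 v|h _ v].
- by rewrite act1 mul1mx.
- by rewrite actM -mulmxA IH1 IH2.
have /imsetP[i Ji ->] := Jc h; rewrite act_gen refl_mxE !mxE andbT.
by rewrite (negPf (contraNneq _ J'j)) ?mulr0 ?subr0 // => ->.
Qed.

(** Move letters of [J] from the right end of [u] to the left end of [x] for as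
    long as [u] has a descent in [J]: the sum of the two lengths cannot grow,
    and it cannot drop below the length of [w]. *)
Lemma parabolic_decomposition J w :
  exists u, exists2 x, x \in parabolic J &
    [/\ w = (u * x)%g, l w = (l u + l x)%N & forall i, i \in J -> ~~ descent u i].
Proof.
suff main b u x : (l u < b)%N -> x \in parabolic J ->
    w = (u * x)%g -> l w = (l u + l x)%N ->
  exists u, exists2 x, x \in parabolic J &
    [/\ w = (u * x)%g, l w = (l u + l x)%N & forall i, i \in J -> ~~ descent u i].
  by apply: (main _ w 1%g (ltnSn _)); rewrite ?group1 ?mulg1 ?cox_length1 ?addn0.
elim: b u x => // b IHb u x; rewrite ltnS => le_u Jx def_w lw.
have [/existsP[i /andP[Ji desc]]|] := boolP [exists i, (i \in J) && descent u i].
  have lu := descent_length desc.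
  have def_w' : w = (u * s i * (s i * x))%g by rewrite mulgA mulg_genK.
  apply: (IHb (u * s i)%g (s i * x)%g) => //.
  - by rewrite -lu.
  - by rewrite groupM ?parabolic_gen.
  have := cox_lengthM (u * s i)%g (s i * x)%g; rewrite -def_w' lw lu.
  by have := cox_length_genmul x i; lia.
rewrite negb_exists => /forallP nodesc; exists u, x => //; split=> // i Ji.
by have := nodesc i; rewrite Ji.
Qed.

Lemma parabolic_descent J w i :
  w \in parabolic J -> descent w i -> i \in J.
Proof.
move=> Jw; rewrite descentE => /forallP/(_ i); apply: contraTT => J'i.
by rewrite (act_parabolic _ Jw J'i) simple_rootE eqxx.
Qed.

Lemma act_descent_nonpos (J : {set 'I_n}) w v :
  (forall i, i \in J -> descent w i) -> (forall j, j \notin J -> v j 0 = 0) ->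
  nonneg v -> nonposb (act w *m v).
Proof.
move=> Jw J'v v0; apply/forallP=> k; rewrite (cV_simple_root v) mulmx_sumr summxE.
apply: sumr_le0 => i _; rewrite -scalemxAr mxE.
have [/Jw|/J'v->] := boolP (i \in J); last by rewrite mul0r.
by rewrite descentE => /forallP/(_ k); apply: mulr_ge0_le0.
Qed.

(** If [x y^-1] had a descent [i], compare the signs of [a_i] and of its images
    under [y^-1] and [x y^-1]: both [x] and [y] turn the nonnegative vectors
    supported in [J] into nonpositive ones, and these three signs are
    incompatible. *)
Lemma parabolic_top_uniq J x y :
  x \in parabolic J -> (forall i, i \in J -> descent x i) ->
  y \in parabolic J -> (forall i, i \in J -> descent y i) -> x = y.
Proof.
move=> Jx dx Jy dy; apply/eqP; rewrite -divg_eq1; apply: contraT.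
case/descent_ex=> i desc_i.
have Ji := parabolic_descent (groupM Jx (groupVr Jy)) desc_i.
set g := act y^-1%g *m a i.
have J'g j : j \notin J -> g j 0 = 0.
  move=> J'j; rewrite (act_parabolic _ (groupVr Jy) J'j) simple_rootE.
  by rewrite (negPf (contraNneq _ J'j)) // => ->.
have yg : act y *m g = a i by rewrite -{1}(invgK y) act_mulVg.
have [desc|/ascent_nonneg g0] := boolP (descent y^-1%g i); last first.
  have /forallP/(_ i) := act_descent_nonpos dy J'g g0.
  by rewrite yg simple_rootE eqxx.
have g0 : nonneg (- g) by apply/nonposbP; rewrite -descentE.
have J'Ng j : j \notin J -> (- g) j 0 = 0 by move=> J'j; rewrite mxE J'g ?oppr0.
have := act_descent_nonpos dx J'Ng g0; rewrite mulmxN => /nonposbP.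
rewrite opprK => xg0; move: desc_i.
rewrite descentE actM -mulmxA -/g => /(nonneg_nonposb xg0) xg.
have /matrixP/(_ i 0) := yg.
by rewrite -(act_mulVg x g) xg !mulmx0 simple_rootE eqxx mxE.
Qed.

Definition longest J : W := [arg max_(w > 1%g in parabolic J) l w].

Lemma longestP J :
  longest J \in parabolic J /\ forall i, i \in J -> descent (longest J) i.
Proof.
rewrite /longest; case: arg_maxnP => [|x Jx max_x]; first exact: group1.
split=> // i Ji; apply: contraT => /ascent_length lt_x.
have := max_x (x * s i)%g; rewrite groupM ?parabolic_gen // => /(_ isT).
by rewrite /= lt_x ltnn.
Qed.

Lemma weak_le_descent u w i : weak_le u w -> descent u i -> descent w i.
Proof.
case/connectP=> p; elim: p u => [|x p IHp] u /=; first by move=> _ ->.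
case/andP=> /existsP[j /andP[/eqP def_x /eqP lv]] pth /(IHp x pth){IHp} IH desc.
apply: IH; rewrite /descent lv def_x -mulgA ltnS.
by apply: leq_trans (cox_length_genmul _ _) _; rewrite -(descent_length desc).
Qed.

Lemma weak_le_suffix u x : l (u * x)%g = (l u + l x)%N -> weak_le x (u * x)%g.
Proof.
have [t def_u size_t] := cox_lengthP u; rewrite -size_t def_u => {u def_u size_t}.
elim: t => [|i t IHt] /=; first by rewrite big_nil mul1g => _; apply: weak_le_refl.
rewrite big_cons -mulgA => E.
have lt : l (\prod_(j <- t) s j * x)%g = (size t + l x)%N.
  apply/eqP; rewrite eqn_leq -ltnS -[X in _ && X]ltnS -addSn -E cox_length_genmul andbT.
  apply: leq_ltn_trans (cox_lengthM _ _) _; rewrite E addSn ltnS leq_add2r.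
  exact: cox_length_le.
apply: weak_le_trans (IHt lt) _; apply: connect1; apply/existsP; exists i.
by rewrite eqxx E lt addSn eqxx.
Qed.

(** When all of [J] is made of descents of [w], the factor [x] in [J] of the
    decomposition [w = u x] inherits them, because [u] keeps the vectors
    supported in [J] nonnegative. Thus [x] is the longest element. *)
Lemma longest_le J w :
  weak_le (longest J) w = (J \subset [set i | descent w i]).
Proof.
have [Jx dx] := longestP J.
apply/idP/subsetP=> [le_w i Ji|Jw].
  by rewrite inE; apply: weak_le_descent le_w (dx i Ji).
have [v [x Jx' [def_w lw vJ]]] := parabolic_decomposition J w.
suff -> : longest J = x by rewrite def_w; apply: weak_le_suffix; rewrite -def_w.
apply: (parabolic_top_uniq Jx dx Jx') => i Ji; apply: contraT => /ascent_nonneg x0.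
have: i \in [set i | descent w i] by apply: Jw.
rewrite inE descentE def_w actM -mulmxA => wi.
have vx0 : nonneg (act v *m (act x *m a i)).
  move=> k; rewrite (cV_simple_root (act x *m a i)) mulmx_sumr summxE sumr_ge0 //.
  move=> j _; rewrite -scalemxAr mxE.
  have [Jj|J'j] := boolP (j \in J).
    by rewrite mulr_ge0 ?x0 ?(ascent_nonneg (vJ j Jj)).
  rewrite (act_parabolic _ Jx' J'j) simple_rootE.
  by rewrite (negPf (contraNneq _ J'j)) ?mul0r // => ->.
have /matrixP/(_ i 0) := act_mulVg x (a i).
rewrite -[X in _ *m X](act_mulVg v) (nonneg_nonposb vx0 wi) !mulmx0.
by rewrite simple_rootE eqxx mxE.
Qed.

(** * The Moebius function of the weak order *)

(** By induction on the length, the right-hand side satisfies the recursion of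
    the Moebius function: exchanging the sums over [t <= w] and over [J] leaves
    the subsets [J] of the descent set of [w]. *)
Lemma mobius_longest w :
  mobius (1%g : weakOrder W) (w : weakOrder W)
    = \sum_(J | longest J == w) (-1) ^+ #|J|.
Proof.
have le1 x : ((1%g : weakOrder W) <= (x : weakOrder W))%O.
  by have := @weak_le_suffix x 1%g; rewrite mulg1 cox_length1 addn0; apply.
have [b] := ubnP (l w); elim: b w => // b IHb w; rewrite ltnS => le_w.
rewrite mobiusE (eq_bigr (fun t => \sum_(J | longest J == t) (-1) ^+ #|J|)); last first.
  move=> t /andP[_]; rewrite lt_neqAle => /andP[neq_tw le_tw].
  apply: IHb; apply: leq_trans le_w.
  by have [le eqE] := weak_le_length le_tw; rewrite ltn_neqAle le eqE neq_tw.
have <- : \sum_(J | weak_le (longest J) w) (-1) ^+ #|J|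
    = ((1%g : weakOrder W) == w)%:R :> int.
  rewrite (eq_bigl (fun J => J \subset [set i | descent w i])); last first.
    by move=> J; rewrite longest_le.
  rewrite sum_sign_subset; congr (nat_of_bool _)%:R; apply/eqP/eqP => [D0|<-].
    apply/esym/eqP; apply: contraT => /descent_ex[i].
    by have /setP/(_ i) := D0; rewrite !inE => ->.
  by apply/setP=> i; rewrite !inE /descent cox_length1.
rewrite (exchange_big_dep (fun J => weak_le (longest J) w)) /=; last first.
  by move=> t J /andP[_ /ltW le_tw] /eqP->.
rewrite (bigID (fun J => longest J == w)) /= [X in _ + X - _](_ : _ =
   \sum_(J | weak_le (longest J) w)
     \sum_(t : weakOrder W | ((1%g : weakOrder W) <= t < w)%O && (longest J == t))
       (-1) ^+ #|J|).
  rewrite addrK; apply: eq_bigl => J; rewrite andbC.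
  by case: eqP => // ->; rewrite weak_le_refl.
rewrite [RHS](bigID (fun J => longest J == w)) /=.
rewrite [X in _ = X + _]big1 ?add0r; last first.
  move=> J /andP[_ /eqP->]; rewrite big_pred0 // => t.
  by rewrite le1 /=; case: (eqVneq w t) => [->|]; rewrite ?ltxx ?andbF.
apply: eq_bigr => J /andP[le_J neq_J].
rewrite (big_pred1 (longest J : weakOrder W)) // => t.
rewrite le1 /= eq_sym; case: eqVneq => [->|]; rewrite ?andbF // andbT.
by rewrite lt_neqAle neq_J; apply: le_J.
Qed.

Lemma mod_charpoly_longest :
  mod_charpoly W = \sum_(J : {set 'I_n}) (-1) ^+ #|J| * 'X^(l (longest J)).
Proof.
rewrite /mod_charpoly (partition_big longest xpredT) //=; apply: eq_bigr => w _.
rewrite mobius_longest -mul_polyC rmorph_sum mulr_suml; apply: eq_bigr => J /eqP->.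
by rewrite /= rmorphXn /= rmorphN1.
Qed.

(** * Lengths as numbers of positive roots *)

Section PositiveRoots.

(* Since [- a_i] is not nonnegative, [P_nonneg] and [P_closed] force [s_i] to
   permute the elements of [P] other than [a_i], as it does for positive
   roots. *)
Variable P : seq 'cV[int]_n.
Hypothesis P_uniq : uniq P.
Hypothesis P_nonneg : forall v, v \in P -> nonneg v.
Hypothesis P_neq0 : forall v, v \in P -> v != 0.
Hypothesis P_simple : forall i, a i \in P.
Hypothesis P_closed : forall i v, v \in P -> v != a i -> refl_mx C i *m v \in P.

Lemma refl_perm_positive i :
  perm_eq [seq refl_mx C i *m v | v <- rem (a i) P] (rem (a i) P).
Proof.
have rK : involutive (fun v => refl_mx C i *m v).
  by move=> v; rewrite /= mulmxA refl_mxK // mul1mx.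
have uniq_r : uniq [seq refl_mx C i *m v | v <- rem (a i) P].
  by rewrite (map_inj_uniq (inv_inj rK)) rem_uniq.
apply: uniq_perm; rewrite ?rem_uniq //.
have sub : {subset [seq refl_mx C i *m v | v <- rem (a i) P] <= rem (a i) P}.
  move=> _ /mapP[v + ->]; rewrite !mem_rem_uniq // !inE => /andP[neq_v Pv].
  rewrite P_closed // andbT; apply: contraTneq Pv => rv.
  apply/negP=> /P_nonneg/(_ i).
  by rewrite -(rK v) rv refl_mx_simple // mxE simple_rootE eqxx.
by have [|_] := uniq_min_size uniq_r sub; rewrite ?size_map.
Qed.

(** Multiplying [w] by [s_i] on the right permutes the roots other than [a_i]
    before [w] acts, so that only the sign of [a_i] changes. *)
Lemma cox_length_count w : l w = count (fun v => nonposb (act w *m v)) P.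
Proof.
have [b] := ubnP (l w); elim: b w => // b IHb w; rewrite ltnS => le_w.
have [->|/descent_ex[i desc]] := eqVneq w 1%g.
  rewrite cox_length1; apply/esym/eqP; rewrite -leqn0 leqNgt -has_count.
  apply/hasPn=> v Pv; rewrite act1 mul1mx; apply/negP.
  by move=> /(nonneg_nonposb (P_nonneg Pv))/eqP; rewrite (negPf (P_neq0 Pv)).
pose u := (w * s i)%g; have def_w : w = (u * s i)%g by rewrite mulg_genK.
have lw := descent_length desc; rewrite -/u in lw.
rewrite lw IHb -?lw // !(seq.permP (perm_to_rem (P_simple i))) /= -!descentE desc.
rewrite descent_mulgen desc /= add0n add1n; congr _.+1.
rewrite -(seq.permP (refl_perm_positive i)) count_map; apply: eq_count => v /=.
by rewrite mulmxA -act_gen -actM -def_w.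
Qed.

(** The longest element of the subgroup of [J] negates all simple roots of [J],
    hence all roots supported in [J]; any other root keeps a positive
    coordinate outside [J]. *)
Lemma longest_length J :
  l (longest J) = count (fun v => [forall j, (j \notin J) ==> (v j 0 == 0)]) P.
Proof.
have [Jx dx] := longestP J.
rewrite cox_length_count; apply: eq_in_count => v Pv.
apply/idP/forallP=> [/forallP le0 j|J'v].
  apply/implyP=> J'j; have := le0 j; rewrite (act_parabolic _ Jx J'j) => vj.
  by rewrite eq_le vj P_nonneg.
apply: act_descent_nonpos dx _ (P_nonneg Pv) => j J'j.
by have := J'v j; rewrite J'j => /eqP.
Qed.

Lemma mod_charpoly_roots :
  mod_charpoly W = \sum_(J : {set 'I_n}) (-1) ^+ #|J| *
    'X^(count (fun v => [forall j, (j \notin J) ==> (v j 0 == 0)]) P).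
Proof.
by rewrite mod_charpoly_longest; apply: eq_bigr => J _; rewrite longest_length.
Qed.

End PositiveRoots.

End GeometricAction.

Lemma geometric_representation n (m : 'I_n -> 'I_n -> nat)
    (W : finCoxeterSystem m) (C : 'I_n -> 'I_n -> int) : cartan_for m C ->
  exists2 act : W -> 'M[int]_n,
    act 1%g = 1%:M /\ (forall u w, act (u * w)%g = act u *m act w) &
    forall i, act (cox_gen W i) = refl_mx C i.
Proof.
move=> mC; have [C2 _] := mC; have [m1 _ _] := cox_matrix W.
have [f fE] := cox_universal W (refl_gl_rel C2 m1 mC).
exists (fun w => (val (f w)).1) => [|i]; last by rewrite fE.
split=> [|u w]; last by rewrite gmulfM.
have -> : f 1%g = 1%g by apply: (mulgI (f 1%g)); rewrite -gmulfM !mulg1.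
by [].
Qed.

(** * Root families along a growing diagram *)

Section NeighbourCartan.

Variables (n : nat) (sg : 'I_n -> 'I_n) (nbrs : nat -> seq nat).
Hypothesis sgK : involutive sg.

(** A diagram is encoded by lists of neighbours of its vertices, and [p] is
    repeated in [nbrs q] to record an off-diagonal entry [-2]. *)
Definition nbr_cartan (i j : 'I_n) : int :=
  2 * (sg i == sg j)%:Z - (count_mem (sg j : nat) (nbrs (sg i)))%:Z.

Definition root_col (f : nat -> nat) : 'cV[int]_n := \col_i (f (sg i))%:Z.

Lemma sum_count_mem (f : nat -> int) (s : seq nat) :
  (forall k, (n <= k)%N -> f k = 0) ->
  \sum_(q < n) (count_mem (q : nat) s)%:Z * f q = \sum_(q <- s) f q.
Proof.
move=> f0; elim: s => [|p s IHs].
  by rewrite big_nil big1 // => q _; rewrite mul0r.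
rewrite big_cons -IHs (eq_bigr (fun q : 'I_n =>
    (p == q :> nat)%:Z * f q + (count_mem (q : nat) s)%:Z * f q)); last first.
  by move=> q _; rewrite /= PoszD mulrDl.
rewrite big_split /=; congr (_ + _).
have [lt_pn|le_np] := ltnP p n.
  rewrite (bigD1 (Ordinal lt_pn)) //= eqxx mul1r big1 ?addr0 // => q neq_q.
  by rewrite eq_sym; move: neq_q; rewrite -val_eqE /= => /negPf->; rewrite mul0r.
rewrite f0 // big1 // => q _; case: eqP => [E|_]; last by rewrite mul0r.
by have := ltn_ord q; rewrite -E ltnNge le_np.
Qed.

Lemma coroot_root_col i f : (forall k, (n <= k)%N -> f k = 0%N) ->
  coroot nbr_cartan i (root_col f)
    = 2 * (f (sg i))%:Z - (\sum_(q <- nbrs (sg i)) f q)%:Z.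
Proof.
move=> f0; rewrite /coroot (reindex_inj (inv_inj sgK)) /=.
rewrite (eq_bigr (fun q : 'I_n => 2 * ((sg i == q)%:Z * (f q)%:Z)
    - (count_mem (q : nat) (nbrs (sg i)))%:Z * (f q)%:Z)); last first.
  by move=> q _; rewrite /nbr_cartan mxE !sgK mulrBl mulrA.
rewrite sumrB -mulr_sumr; congr (2 * _ - _).
  rewrite (bigD1 (sg i)) //= eqxx mul1r big1 ?addr0 // => q.
  by rewrite eq_sym => /negPf->; rewrite mul0r.
rewrite (sum_count_mem (f := fun q => (f q)%:Z)) => [|k /f0->//].
by rewrite -[RHS]/(Posz _) (big_morph Posz PoszD (erefl _)).
Qed.

End NeighbourCartan.

(** [(t, a, b)] names a positive root supported on vertices up to [b]. In the
    usual coordinates, the vertex [k >= 1] stands for [e_k - e_(k - 1)], and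
    [0] for [e_0 - e_(-1)] in type A, for [e_0] in type B and for [e_0 + e_1] in
    type D. If [t] is false the root is the sum of the simple roots of the
    segment [a, ..., b], that is, [e_b - e_(a - 1)], read as [e_b] if [a = 0] in
    type B; if [t] is true it is [e_b + e_a]. *)
Definition root_index : Type := bool * nat * nat.

Section RootFamily.

Variables (segs cross : nat -> seq nat) (crossroot : nat -> nat -> nat -> nat).
Variable nbrs : nat -> seq nat.

Definition root (x : root_index) (k : nat) : nat :=
  let: (t, a, b) := x in
  if t then crossroot a b k else nat_of_bool (a <= k <= b)%N.

Definition level (b : nat) : seq root_index :=
  [seq (false, a, b) | a <- segs b] ++ [seq (true, a, b) | a <- cross b].

Fixpoint roots (N : nat) : seq root_index :=
  if N is N'.+1 then roots N' ++ level N' else [::].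

Lemma mem_level t a b b' :
  ((t, a, b) \in level b') = (b == b') && (a \in (if t then cross b else segs b)).
Proof.
have mem_map (s : seq nat) t' : ((t, a, b) \in [seq (t', c, b') | c <- s])
    = [&& t == t', b == b' & a \in s].
  apply/mapP/and3P => [[c sc [-> -> ->]]|[/eqP-> /eqP-> sa]]; first by rewrite !eqxx.
  by exists a.
rewrite mem_cat !mem_map.
by case: (b =P b') => [<-|]; case: t {mem_map}; rewrite /= ?orbF.
Qed.

Lemma mem_roots t a b N :
  ((t, a, b) \in roots N) = (b < N)%N && (a \in (if t then cross b else segs b)).
Proof.
elim: N => [|N IHN] //=; rewrite mem_cat IHN mem_level ltnS [in RHS]leq_eqVlt.
by rewrite -andb_orl orbC.
Qed.

Hypothesis segs_uniq : forall b, uniq (segs b).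
Hypothesis cross_uniq : forall b, uniq (cross b).

Lemma roots_uniq N : uniq (roots N).
Proof.
elim: N => //= N IHN; rewrite cat_uniq IHN /=; apply/andP; split.
  apply/hasPn=> -[[t a] b]; rewrite mem_level mem_roots => /andP[/eqP-> _].
  by rewrite ltnn.
rewrite cat_uniq !map_inj_uniq ?segs_uniq ?cross_uniq ?andbT; try by move=> c d [].
by apply/hasPn=> _ /mapP[a _ ->]; apply/negP=> /mapP[].
Qed.

Section Rank.

Variables (n : nat) (sg : 'I_n -> 'I_n).
Hypothesis sgK : involutive sg.

(** The coefficient of [s_i x] at [i] is the sum of the coefficients of [x] at
    the neighbours of [i], minus the coefficient of [x] at [i]: the last clause
    is closure under the simple reflections, stated on natural numbers. *)
Definition root_family : Prop :=
  [/\ forall x, x \in roots n -> forall k, (x.2 < k)%N -> root x k = 0%N,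
      forall x, x \in roots n -> exists2 k, (k < n)%N & root x k <> 0%N,
      forall x y, x \in roots n -> y \in roots n ->
        (forall k, root x k = root y k) -> x = y,
      forall i, (i < n)%N ->
        exists2 x, x \in roots n & forall k, root x k = (k == i)
    & forall i x, (i < n)%N -> x \in roots n ->
        (forall k, root x k = (k == i)) \/
        exists2 y, y \in roots n &
          (root y i + root x i = \sum_(q <- nbrs i) root x q)%N /\
          forall k, k <> i -> root y k = root x k].

Lemma mod_charpoly_root_family (m : 'I_n -> 'I_n -> nat)
    (W : finCoxeterSystem m) :
  cartan_for m (nbr_cartan sg nbrs) -> root_family ->
  mod_charpoly W = \sum_(J : {set 'I_n}) (-1) ^+ #|J| *
    'X^(count (fun x => [forall j, (j \notin J) ==> (root x j == 0%N)]) (roots n)).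
Proof.
move=> mC [root_above root_neq0 root_inj simple closed].
have root0 x : x \in roots n -> forall k, (n <= k)%N -> root x k = 0%N.
  move=> Px k le_nk; apply: root_above => //; apply: leq_trans le_nk.
  by case: x Px => [[t a] b]; rewrite mem_roots => /andP[].
have [act [act1 actM] act_gen] := geometric_representation W mC.
have col_inj x y : x \in roots n -> y \in roots n ->
    root_col sg (root x) = root_col sg (root y) -> x = y.
  move=> Px Py /matrixP E; apply: root_inj => // k.
  have [lt_kn|le_nk] := ltnP k n; last by rewrite !root0.
  by have := E (sg (Ordinal lt_kn)) 0; rewrite !mxE sgK => -[].
have col_simple i x : (forall k, root x k = (k == sg i :> nat)) ->
    root_col sg (root x) = simple_root i.
  move=> xE; apply/matrixP=> k z; rewrite ord1 simple_rootE mxE xE.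
  by rewrite val_eqE (inj_eq (inv_inj sgK)); case: eqP.
rewrite (mod_charpoly_roots mC act1 actM act_gen
           (P := [seq root_col sg (root x) | x <- roots n])).
- rewrite (reindex_inj (h := fun J : {set 'I_n} => sg @: J)); last first.
    exact: imset_inj (inv_inj sgK).
  apply: eq_bigr => J _; rewrite card_imset; last exact: inv_inj.
  congr (_ * 'X^_); rewrite count_map; apply: eq_count => x /=.
  apply/forallP/forallP => H j; have := H (sg j).
    by rewrite mem_imset ?mxE ?sgK //; apply: inv_inj.
  by rewrite -[in X in _ -> X](sgK j) mem_imset ?mxE ?sgK //; apply: inv_inj.
- rewrite map_inj_in_uniq ?roots_uniq // => x y; exact: col_inj.
- by move=> _ /mapP[x _ ->] k; rewrite mxE.
- move=> _ /mapP[x Px ->]; apply/eqP=> /matrixP E.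
  have [k lt_kn] := root_neq0 x Px; have := E (sg (Ordinal lt_kn)) 0.
  by rewrite !mxE sgK => /eqP; rewrite eqz_nat => /eqP.
- move=> i; have [x Px xE] := simple _ (ltn_ord (sg i)).
  by apply/mapP; exists x => //; rewrite (col_simple i x).
move=> i _ /mapP[x Px ->] neq.
case: (closed _ x (ltn_ord (sg i)) Px) => [xE|[y Py [yi yE]]].
  by rewrite (col_simple i x) ?eqxx in neq.
apply/mapP; exists y => //; rewrite refl_mxE coroot_root_col //; last exact: root0.
apply/matrixP=> k z; rewrite ord1 !mxE andbT -yi.
have [->|neq_k] := eqVneq k i; first by rewrite PoszD mulr1; ring.
rewrite mulr0 subr0 yE // => E; case/eqP: neq_k; apply: (inv_inj sgK).
exact: val_inj.
Qed.

End Rank.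

End RootFamily.

(** * Splitting a set of vertices at its topmost gap *)

(** A subset of [0, ..., n - 1] seen as a predicate on all natural numbers, so
    that subsets of diagrams of different sizes can be compared. *)
Definition memn n (J : {set 'I_n}) (k : nat) : bool :=
  [exists j, (j \in J) && (j == k :> nat)].

Lemma memnE n (J : {set 'I_n}) (j : 'I_n) : memn J j = (j \in J).
Proof.
apply/existsP/idP=> [[i /andP[Ji /eqP/val_inj<-]] //|Jj].
by exists j; rewrite Jj eqxx.
Qed.

Lemma memn_ge n (J : {set 'I_n}) k : (n <= k)%N -> memn J k = false.
Proof.
move=> le_nk; apply/existsP=> -[j /andP[_ /eqP jk]].
by have := ltn_ord j; rewrite jk ltnNge le_nk.
Qed.

Lemma memn_lift n (J : {set 'I_n}) k : memn (lift ord_max @: J) k = memn J k.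
Proof.
apply/existsP/existsP=> [[_ /andP[/imsetP[j Jj ->] /eqP<-]]|[j /andP[Jj /eqP<-]]].
  by exists j; rewrite Jj lift_max eqxx.
by exists (lift ord_max j); rewrite lift_max eqxx andbT imset_f.
Qed.

Lemma memn_max n (J : {set 'I_n}) k :
  memn (ord_max |: lift ord_max @: J) k = memn J k || (k == n).
Proof.
rewrite -(memn_lift J); apply/existsP/orP=> [[j /andP[]]|].
  rewrite in_setU1 => /predU1P[->|Jj] /eqP<-; first by right.
  by left; apply/existsP; exists j; rewrite Jj eqxx.
case=> [/existsP[j /andP[Jj /eqP<-]]|/eqP->].
  by exists j; rewrite in_setU1 Jj orbT eqxx.
by exists ord_max; rewrite setU11 eqxx.
Qed.

Lemma max_notin_lift n (J : {set 'I_n}) : ord_max \notin lift ord_max @: J.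
Proof. by apply/imsetP=> -[j _ /eqP]; rewrite (negPf (neq_lift _ _)). Qed.

Lemma big_set_max n (R : nmodType) (F : {set 'I_n.+1} -> R) :
  \sum_J F J = \sum_(J : {set 'I_n}) F (lift ord_max @: J)
    + \sum_(J : {set 'I_n}) F (ord_max |: lift ord_max @: J).
Proof.
have liftI := @lift_inj _ (@ord_max n).
have preK (J : {set 'I_n}) : lift ord_max @^-1: (lift ord_max @: J) = J.
  by apply/setP=> j; rewrite inE mem_imset.
have preUK (J : {set 'I_n}) : lift ord_max @^-1: (ord_max |: lift ord_max @: J) = J.
  by apply/setP=> j; rewrite !inE mem_imset // eq_sym (negPf (neq_lift _ _)).
have imK (J : {set 'I_n.+1}) : J :\ ord_max = lift ord_max @: (lift ord_max @^-1: J).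
  apply/setP=> j; rewrite in_setD1; case: (unliftP ord_max j) => [j' ->|->].
    by rewrite mem_imset // inE eq_sym (negPf (neq_lift _ _)).
  by rewrite eqxx (negPf (max_notin_lift _)).
rewrite (bigID (fun J : {set 'I_n.+1} => ord_max \notin J)) /=; congr (_ + _).
  rewrite (reindex_onto (fun J : {set 'I_n} => lift ord_max @: J)
                        (fun J => lift ord_max @^-1: J)) /=; last first.
    move=> J J'max; rewrite -imK; apply/setP=> j; rewrite in_setD1.
    by case: eqP => // ->; rewrite (negPf J'max).
  by apply: eq_bigl => J; rewrite max_notin_lift preK eqxx.
rewrite (reindex_onto (fun J : {set 'I_n} => ord_max |: lift ord_max @: J)
                      (fun J => lift ord_max @^-1: J)) /=; last first.
  by move=> J; rewrite negbK -imK => /setD1K.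
by apply: eq_bigl => J; rewrite setU11 preUK eqxx.
Qed.

Lemma big_set_ord0 (R : nmodType) (F : {set 'I_0} -> R) : \sum_J F J = F set0.
Proof.
rewrite (big_pred1 set0) // => J; apply/esym/eqP.
by apply/setP=> -[].
Qed.

Section SubsetPolynomial.

Variables (segs cross : nat -> seq nat) (crossroot : nat -> nat -> nat -> nat).
Local Notation root := (root crossroot).
Local Notation level := (level segs cross).
Local Notation roots := (roots segs cross).
Implicit Types (J K : pred nat) (x : root_index).

Definition supported J x : bool :=
  all (fun k => J k || (root x k == 0%N)) (iota 0 x.2.+1).

Definition level_rank b J : nat := count (supported J) (level b).

Definition rank N J : nat := (\sum_(b < N) level_rank b J)%N.

Lemma rank_count N J : rank N J = count (supported J) (roots N).
Proof.
by elim: N => [|N IHN]; rewrite /rank ?big_ord0 // big_ord_recr /= count_cat -IHN.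
Qed.

Lemma level_rank_ext b J K :
  (forall k, (k <= b)%N -> J k = K k) -> level_rank b J = level_rank b K.
Proof.
move=> JK; apply: eq_in_count => -[[t a] c]; rewrite mem_level => /andP[/eqP-> _].
by apply: eq_in_all => k; rewrite mem_iota /= add0n ltnS => /JK->.
Qed.

Lemma rank_ext N J K :
  (forall k, (k < N)%N -> J k = K k) -> rank N J = rank N K.
Proof.
move=> JK; apply: eq_bigr => b _; apply: level_rank_ext => k le_kb.
by apply: JK; apply: leq_ltn_trans le_kb _.
Qed.

Definition subset_poly n : {poly int} :=
  \sum_(J : {set 'I_n}) (-1) ^+ #|J| * 'X^(rank n (memn J)).

Lemma mod_charpoly_subset_poly n (sg : 'I_n -> 'I_n) nbrs
    (m : 'I_n -> 'I_n -> nat) (W : finCoxeterSystem m) :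
  (forall b, uniq (segs b)) -> (forall b, uniq (cross b)) -> involutive sg ->
  cartan_for m (nbr_cartan sg nbrs) ->
  root_family segs cross crossroot nbrs n ->
  mod_charpoly W = subset_poly n.
Proof.
move=> segs_uniq cross_uniq sgK mC fam.
rewrite (mod_charpoly_root_family segs_uniq cross_uniq sgK W mC fam).
apply: eq_bigr => J _; rewrite rank_count; congr (_ * 'X^_).
have [root_above _ _ _ _] := fam.
apply: eq_in_count => x Px; apply/forallP/allP => [H k|H j].
  rewrite mem_iota add0n /= ltnS => le_k.
  have lt_kn : (k < n)%N.
    apply: leq_ltn_trans le_k _.
    by case: x Px {H} => [[t a] b]; rewrite mem_roots => /andP[].
  by have := H (Ordinal lt_kn); rewrite -(memnE J (Ordinal lt_kn)) /= implyNb.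
have [le_j|lt_j] := leqP j x.2; last by rewrite root_above ?implybT.
by have := H j; rewrite mem_iota add0n /= ltnS le_j memnE implyNb => ->.
Qed.

(** The part of [subset_poly (n + r)] that comes from the subsets containing
    all vertices from [n] to [n + r - 1]. *)
Definition full_above n r : {poly int} :=
  \sum_(J : {set 'I_n}) (-1) ^+ (#|J| + r) *
    'X^(rank (n + r) (fun k => memn J k || (n <= k)%N)).

(* From the vertex [n0] on, removing a vertex separates all the vertices above
   it from those below. *)
Variable n0 : nat.
Hypothesis level_gap : forall n b J, (n0 <= n <= b)%N -> ~~ J n ->
  (forall k, (n < k <= b)%N -> J k) -> level_rank b J = (b - n)%N.

(** The [r] vertices above the gap form a path of type A. *)
Lemma rank_gap n r J : (n0 <= n)%N -> ~~ J n -> (forall k, (n < k)%N -> J k) ->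
  rank (n.+1 + r) J = (rank n J + 'C(r.+1, 2))%N.
Proof.
move=> le_n J'n Jgt; elim: r => [|r IHr].
  rewrite addn0 /rank big_ord_recr /= (@level_gap n) ?leqnn ?subnn ?andbT //.
  by move=> k /andP[/Jgt].
rewrite addnS /rank big_ord_recr /= -/(rank _ J) IHr -addnA; congr (_ + _)%N.
rewrite (@level_gap n) ?le_n ?leqW ?leq_addr //; last by move=> k /andP[/Jgt].
by rewrite addSn -addnS addKn [RHS]binS bin1.
Qed.

Lemma full_above0 n : full_above n 0 = subset_poly n.
Proof.
apply: eq_bigr => J _; rewrite !addn0; congr (_ * 'X^_); apply: rank_ext => k.
by rewrite ltnNge => /negPf->; rewrite orbF.
Qed.

(** The two terms are the subsets without and with the vertex [n]. *)
Lemma full_aboveS n r : (n0 <= n)%N ->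
  full_above n.+1 r =
    subset_poly n * ((-1) ^+ r * 'X^('C(r.+1, 2))) + full_above n r.+1.
Proof.
move=> le_n; rewrite /full_above big_set_max; congr (_ + _).
  rewrite mulr_suml; apply: eq_bigr => J _.
  rewrite card_imset; last exact: lift_inj.
  rewrite rank_gap //; last first.
  - by move=> k ->; rewrite orbT.
  - by rewrite memn_lift memn_ge ?ltnn.
  rewrite (@rank_ext n _ (memn J)) ?exprD; first by rewrite mulrACA.
  by move=> k lt_kn; rewrite memn_lift ltnNge (ltnW lt_kn) orbF.
apply: eq_bigr => J _; rewrite addSnnS cardsU1 max_notin_lift.
rewrite card_imset; last exact: lift_inj.
rewrite [(1 + _)%N]addnC -addnA add1n; congr (_ * 'X^_).
by apply: rank_ext => k _; rewrite memn_max -orbA (eq_sym k) -leq_eqVlt.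
Qed.

(** Iterating [full_aboveS] lowers the block of vertices known to be present
    from [n0 + m] down to [n0], one topmost gap [n0 + k] at a time. *)
Lemma subset_poly_recursion m :
  \sum_(k < m.+1) subset_poly (n0 + k) * ((-1) ^+ (m - k) * 'X^('C(m - k, 2)))
    = full_above n0 m.
Proof.
suff main j : (j <= m)%N -> full_above (n0 + j) (m - j) = full_above n0 m
    + \sum_(k < j) subset_poly (n0 + k) * ((-1) ^+ (m - k.+1) * 'X^('C(m - k, 2))).
  rewrite big_ord_recr /= subnn expr0 bin0n expr0 mul1r mulr1 -full_above0.
  have := main m (leqnn m); rewrite subnn => ->; rewrite addrCA -big_split /=.
  rewrite big1 ?addr0 // => k _; rewrite -mulrDr -mulrDl.
  rewrite subnS -{1}(ltn_predK (_ : 0 < m - k)%N) ?subn_gt0 //.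
  by rewrite exprS mulN1r addNr mul0r mulr0.
elim: j => [|j IHj] lt_jm; first by rewrite addn0 subn0 big_ord0 addr0.
rewrite addnS full_aboveS ?leq_addr // big_ord_recr /= subnSK //.
by rewrite IHj ?(ltnW lt_jm) // [RHS]addrA [RHS]addrC.
Qed.

End SubsetPolynomial.

(** * Types A, B and D *)

Definition nbrsA (k : nat) : seq nat :=
  if k is k'.+1 then [:: k'; k.+1] else [:: 1%N].
Definition nbrsB (k : nat) : seq nat :=
  if k is k'.+1 then [:: k'; k.+1] else [:: 1%N; 1%N].
(** The fork sits at the bottom, with [0] and [1] both joined to [2], and the
    path goes upwards from [2]. This reverses the numbering of [coxD], so that
    the diagram grows at the end of the path. *)
Definition nbrsD (k : nat) : seq nat :=
  match k with
  | 0 | 1 => [:: 2%N]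
  | 2 => [:: 0%N; 1%N; 3%N]
  | k'.+1 => [:: k'; k.+1]
  end.

Definition segsA b := iota 0 b.+1.
Definition segsD b := iota 1 b.
Definition crossA (b : nat) : seq nat := [::].
Definition crossB b := iota 0 b.
Definition crossrootA (a b k : nat) : nat := 0%N.
Definition crossrootB (a b k : nat) : nat := ((k <= a) + (k <= b))%N.
Definition crossrootD (a b k : nat) : nat :=
  ((k == 0) + (1 <= k <= a) + (2 <= k <= b))%N.

Lemma coxA_cartan n : cartan_for (@coxA n) (nbr_cartan id nbrsA).
Proof.
split=> [i|i j neq_ij]; rewrite /nbr_cartan /coxA.
  by rewrite eqxx; case: i => -[|k] lt_k /=; lia.
have neq : (i : nat) <> j by move=> /val_inj E; rewrite E eqxx in neq_ij.
rewrite [j == i]eq_sym (negPf neq_ij) /path_edge.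
case: i j neq {neq_ij} => [p lt_p] [q lt_q] /= neq.
have [e|e] := boolP ((q == p.+1) || (p == q.+1)).
  by constructor 2; case: p q e {lt_p lt_q neq} => [|p] [|q] /=; lia.
by constructor 1; case: p q e neq {lt_p lt_q} => [|p] [|q] /=; lia.
Qed.

Lemma coxB_cartan n : cartan_for (@coxB n) (nbr_cartan id nbrsB).
Proof.
split=> [i|i j neq_ij]; rewrite /nbr_cartan /coxB.
  by rewrite eqxx; case: i => -[|k] lt_k /=; lia.
have neq : (i : nat) <> j by move=> /val_inj E; rewrite E eqxx in neq_ij.
rewrite [j == i]eq_sym (negPf neq_ij) /path_edge.
case: i j neq {neq_ij} => [p lt_p] [q lt_q] /= neq.
have [e|e] := boolP ((q == p.+1) || (p == q.+1)); last first.
  by constructor 1; case: p q e neq {lt_p lt_q} => [|p] [|q] /=; lia.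
case: p q e {lt_p lt_q neq} => [|p] [|q] //= e.
- by constructor 4; lia.
- by constructor 3; lia.
by constructor 2; lia.
Qed.

Lemma coxD_cartan n : cartan_for (@coxD n.+2) (nbr_cartan (@rev_ord n.+2) nbrsD).
Proof.
split=> [i|i j neq_ij]; rewrite /nbr_cartan /coxD.
  by rewrite eqxx; case: (nat_of_ord _) => [|[|[|k]]] /=; lia.
have neq : (i : nat) <> j by move=> /val_inj E; rewrite E eqxx in neq_ij.
rewrite !(inj_eq rev_ord_inj) [j == i]eq_sym (negPf neq_ij) /edgeD /forkD /path_edge.
have ip : (i + rev_ord i = n.+1)%N by have := ltn_ord i; rewrite /=; lia.
have jq : (j + rev_ord j = n.+1)%N by have := ltn_ord j; rewrite /=; lia.
move: (nat_of_ord i) (nat_of_ord j) neq ip jq => i' j'.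
move: (nat_of_ord (rev_ord i)) (nat_of_ord (rev_ord j)) => p q neq ip jq.
have [e|e] := boolP [||
    [&& (j' == i'.+1) || (i' == j'.+1), i'.+1 < n.+2 & j'.+1 < n.+2],
    (i'.+3 == n.+2) && (j'.+1 == n.+2) | (j'.+3 == n.+2) && (i'.+1 == n.+2)]%N.
  by constructor 2; case: p q ip jq => [|[|[|p]]] [|[|[|q]]] /=; lia.
by constructor 1; case: p q ip jq => [|[|[|p]]] [|[|[|q]]] /=; lia.
Qed.

(* [witness y] proves that [y] is the image of a root under the reflection. *)
Ltac witness y :=
  exists y; first (by rewrite mem_roots ?mem_iota /=; lia);
  rewrite /= /crossrootB /crossrootD; split;
    [by repeat case: ifP => ?; lia | by move=> k neq_k; lia].

Lemma root_familyA n : root_family segsA crossA crossrootA nbrsA n.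
Proof.
have memA t a b : ((t, a, b) \in roots segsA crossA n) = ~~ t && (a <= b < n)%N.
  by rewrite mem_roots; case: t; rewrite ?in_nil ?andbF // mem_iota; lia.
split=> [[[[] a] b]|[[[] a] b]|[[[] a] b] [[[] c] d]|i lt_in|i [[[] a] b] lt_in];
  rewrite ?memA //=.
- by move=> lt k; lia.
- by move=> lt; exists b; lia.
- move=> lt1 lt2 E; have := E a; have := E b; have := E c; have := E d => E1 E2 E3 E4.
  by have [-> ->] : a = c /\ b = d by lia.
- by exists (false, i, i) => [|k /=]; rewrite ?memA /=; lia.
move=> lt_x.
have nbrE : (\sum_(q <- nbrsA i) (a <= q <= b))%N =
    (((0 < i) && (a <= i.-1 <= b)) + (a <= i.+1 <= b))%N.
  by case: i {lt_in} => [|i]; rewrite !big_cons big_nil addn0.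
rewrite nbrE.
have [ia|ia] := eqVneq i a; have [ib|ib] := eqVneq i b.
- by left=> k; lia.
- by right; witness (false, a.+1, b).
- by right; witness (false, a, b.-1).
right; have [ia'|ia'] := eqVneq i.+1 a; first by witness (false, i, b).
have [ib'|ib'] := eqVneq i b.+1; first by witness (false, a, i).
by witness (false, a, b).
Qed.

(** In the usual coordinates [s_i] exchanges [e_(i - 1)] and [e_i] if [i > 0],
    and [s_0] changes the sign of [e_0]; the cases follow this action. *)
Lemma root_familyB n : root_family segsA crossB crossrootB nbrsB n.
Proof.
have memB t a b : ((t, a, b) \in roots segsA crossB n)
    = (b < n)%N && (if t then a < b else a <= b)%N.
  by rewrite mem_roots; case: t; rewrite mem_iota; lia.
split=> [[[[] a] b]|[[[] a] b]|[[[] a] b] [[[] c] d]|i lt_in|i [[t a] b] lt_in];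
  rewrite ?memB /= /crossrootB.
- by move=> lt k; lia.
- by move=> lt k; lia.
- by move=> lt; exists b; lia.
- by move=> lt; exists b; lia.
- move=> lt1 lt2 E; have := E a; have := E b; have := E c; have := E d => E1 E2 E3 E4.
  by have [-> ->] : a = c /\ b = d by lia.
- by move=> lt1 lt2 E; have := E 0%N; lia.
- by move=> lt1 lt2 E; have := E 0%N; lia.
- move=> lt1 lt2 E; have := E a; have := E b; have := E c; have := E d => E1 E2 E3 E4.
  by have [-> ->] : a = c /\ b = d by lia.
- by exists (false, i, i) => [|k /=]; rewrite ?memB /=; lia.
have nbrE f : (\sum_(q <- nbrsB i) f q)%N
    = (if i == 0 then (f 1 + f 1)%N else (f i.-1 + f i.+1)%N).
  by case: i {lt_in} => [|i]; rewrite !big_cons big_nil addn0.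
rewrite nbrE {nbrE}; case: t => lt_x /=.
  right; have [i0|i0] := eqVneq i 0%N.
    by have [a0|a0] := eqVneq a 0%N;
      [witness (false, 1%N, b) | witness (true, a, b)].
  have [ia|ia] := eqVneq i a; first by witness (true, a.-1, b).
  have [ib|ib] := eqVneq i b.
    by have [ab|ab] := eqVneq a.+1 b; [witness (true, a, b) | witness (true, a, b.-1)].
  have [ia'|ia'] := eqVneq i a.+1; first by witness (true, i, b).
  have [ib'|ib'] := eqVneq i b.+1; first by witness (true, a, i).
  by witness (true, a, b).
have [i0|i0] := eqVneq i 0%N.
  have [a0|a0] := eqVneq a 0%N.
    have [b0|b0] := eqVneq b 0%N; first by left=> k; lia.
    by right; witness (false, a, b).
  by right; have [a1|a1] := eqVneq a 1%N;
    [witness (true, 0%N, b) | witness (false, a, b)].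
have [ia|ia] := eqVneq i a; have [ib|ib] := eqVneq i b.
- by left=> k; lia.
- by right; witness (false, a.+1, b).
- by right; witness (false, a, b.-1).
right; have [ia'|ia'] := eqVneq i.+1 a; first by witness (false, i, b).
have [ib'|ib'] := eqVneq i b.+1; first by witness (false, a, i).
by witness (false, a, b).
Qed.

(** As in type B, except that [s_0] exchanges [e_0] and [- e_1]. *)
Lemma root_familyD n : (1 < n)%N -> root_family segsD crossB crossrootD nbrsD n.
Proof.
move=> n_gt1.
have memD t a b : ((t, a, b) \in roots segsD crossB n)
    = (b < n)%N && (if t then a < b else 0 < a <= b)%N.
  by rewrite mem_roots; case: t; rewrite mem_iota; lia.
split=> [[[[] a] b]|[[[] a] b]|[[[] a] b] [[[] c] d]|i lt_in|i [[t a] b] lt_in];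
  rewrite ?memD /= /crossrootD.
- by move=> lt k; lia.
- by move=> lt k; lia.
- by move=> lt; exists 0%N; lia.
- by move=> lt; exists b; lia.
- move=> lt1 lt2 E.
  have bd : b = d by have := E b; have := E d; lia.
  by have -> : a = c; [have := E a; have := E c; lia | rewrite bd].
- by move=> lt1 lt2 E; have := E 0%N; lia.
- by move=> lt1 lt2 E; have := E 0%N; lia.
- move=> lt1 lt2 E; have := E a; have := E b; have := E c; have := E d => E1 E2 E3 E4.
  by have [-> ->] : a = c /\ b = d by lia.
- have [i0|i0] := eqVneq i 0%N.
    by exists (true, 0%N, 1%N) => [|k /=]; rewrite ?memD /crossrootD /=; lia.
  by exists (false, i, i) => [|k /=]; rewrite ?memD /=; lia.
have nbrE f : (\sum_(q <- nbrsD i) f q)%N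
    = (if i <= 1 then f 2 else if i == 2 then f 0 + f 1 + f 3 else f i.-1 + f i.+1)%N.
  by case: i {lt_in} => [|[|[|i]]]; rewrite !big_cons big_nil ?addn0 ?addnA.
rewrite nbrE {nbrE}; case: t => lt_x /=.
  have [i0|i0] := eqVneq i 0%N.
    have [a0|a0] := eqVneq a 0%N.
      have [b1|b1] := eqVneq b 1%N; first by left=> k; lia.
      by right; witness (false, 2%N, b).
    by right; have [a1|a1] := eqVneq a 1%N;
      [witness (false, 1%N, b) | witness (true, a, b)].
  right; have [ia|ia] := eqVneq i a; first by witness (true, a.-1, b).
  have [ib|ib] := eqVneq i b.
    by have [ab|ab] := eqVneq a.+1 b; [witness (true, a, b) | witness (true, a, b.-1)].
  have [ia'|ia'] := eqVneq i a.+1; first by witness (true, i, b).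
  have [ib'|ib'] := eqVneq i b.+1; first by witness (true, a, i).
  by witness (true, a, b).
have [i0|i0] := eqVneq i 0%N.
  right; have [b1|b1] := eqVneq b 1%N; first by witness (false, a, b).
  have [a1|a1] := eqVneq a 1%N; first by witness (true, 1%N, b).
  by have [a2|a2] := eqVneq a 2%N;
    [witness (true, 0%N, b) | witness (false, a, b)].
have [ia|ia] := eqVneq i a; have [ib|ib] := eqVneq i b.
- by left=> k; lia.
- by right; witness (false, a.+1, b).
- by right; witness (false, a, b.-1).
right; have [ia'|ia'] := eqVneq i.+1 a; first by witness (false, i, b).
have [ib'|ib'] := eqVneq i b.+1; first by witness (false, a, i).
by witness (false, a, b).
Qed.

Section Gaps.

Variables (segs cross : nat -> seq nat) (crossroot : nat -> nat -> nat -> nat).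
Implicit Types J : pred nat.

Lemma supported_seg_gap J n a b : (n <= b)%N -> ~~ J n ->
  (forall k, (n < k <= b)%N -> J k) ->
  supported crossroot J (false, a, b) = (n < a)%N.
Proof.
move=> le_nb J'n Jgt; apply/allP/idP=> [/(_ n)|lt_na k].
  by rewrite mem_iota /= (negPf J'n); lia.
rewrite mem_iota /= => lt_kb; case: (leqP a k) => [le_ak|]; last by rewrite orbT.
by rewrite Jgt //; lia.
Qed.

Lemma count_gt_iota n c m : (c <= n.+1)%N ->
  count (fun a => (n < a)%N) (iota c m) = (c + m - n.+1)%N.
Proof.
move=> le_cn; elim: m => [|m IHm]; first by rewrite addn0 /=; lia.
by rewrite -[in LHS](addn1 m) iotaD count_cat IHm /=; lia.
Qed.

(** The cross roots contain the gap [n] by hypothesis, and a segment that ends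
    at [b] avoids [n] exactly when it starts above [n]. *)
Lemma level_rank_gap J n b :
  (n <= b)%N -> ~~ J n -> (forall k, (n < k <= b)%N -> J k) ->
  (forall a, a \in cross b -> crossroot a b n <> 0%N) ->
  level_rank segs cross crossroot b J = count (fun a => (n < a)%N) (segs b).
Proof.
move=> le_nb J'n Jgt crossn; rewrite /level_rank count_cat !count_map.
rewrite [X in (_ + X)%N](_ : _ = 0%N) ?addn0.
  by apply: eq_count => a /=; rewrite (supported_seg_gap _ le_nb).
apply/eqP; rewrite -leqn0 leqNgt -has_count; apply/hasPn=> a cross_a /=.
apply/negP=> /allP/(_ n); rewrite mem_iota /= (negPf J'n) /= => H.
by apply: (crossn a cross_a); apply/eqP/H; rewrite add0n ltnS.
Qed.

Lemma level_rank_full J b : (forall k, J k) ->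
  level_rank segs cross crossroot b J = (size (segs b) + size (cross b))%N.
Proof.
move=> Jall; rewrite /level_rank (eq_count (a2 := predT)).
  by rewrite count_predT size_cat !size_map.
by move=> x; apply/allP=> k _; rewrite Jall.
Qed.

End Gaps.

Lemma level_gapA n b (J : pred nat) : (0 <= n <= b)%N -> ~~ J n ->
  (forall k, (n < k <= b)%N -> J k) ->
  level_rank segsA crossA crossrootA b J = (b - n)%N.
Proof.
by move=> /andP[_ le_nb] J'n Jgt; rewrite (level_rank_gap _ le_nb) // count_gt_iota.
Qed.

Lemma level_gapB n b (J : pred nat) : (0 <= n <= b)%N -> ~~ J n ->
  (forall k, (n < k <= b)%N -> J k) ->
  level_rank segsA crossB crossrootB b J = (b - n)%N.
Proof.
move=> /andP[_ le_nb] J'n Jgt.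
rewrite (level_rank_gap _ le_nb) // ?count_gt_iota //.
by move=> a _; rewrite /crossrootB; lia.
Qed.

Lemma level_gapD n b (J : pred nat) : (1 < n <= b)%N -> ~~ J n ->
  (forall k, (n < k <= b)%N -> J k) ->
  level_rank segsD crossB crossrootD b J = (b - n)%N.
Proof.
move=> /andP[n_gt1 le_nb] J'n Jgt.
rewrite (level_rank_gap _ le_nb) // ?count_gt_iota //.
by move=> a _; rewrite /crossrootD; lia.
Qed.

Lemma full_aboveA m : full_above segsA crossA crossrootA 0 m
  = (-1) ^+ m * 'X^('C(m.+1, 2)).
Proof.
rewrite /full_above big_set_ord0 cards0 !add0n; congr (_ * 'X^_).
elim: m => [|m IHm]; rewrite /rank ?big_ord0 // big_ord_recr /= -/(rank _ _ _ m _) IHm.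
rewrite level_rank_full => [|k]; last by rewrite orbT.
by rewrite size_iota addn0 [in RHS]binS bin1.
Qed.

Lemma full_aboveB m : full_above segsA crossB crossrootB 0 m
  = (-1) ^+ m * 'X^(m ^ 2).
Proof.
rewrite /full_above big_set_ord0 cards0 !add0n; congr (_ * 'X^_).
elim: m => [|m IHm]; rewrite /rank ?big_ord0 // big_ord_recr /= -/(rank _ _ _ m _) IHm.
rewrite level_rank_full => [|k]; last by rewrite orbT.
by rewrite !size_iota; lia.
Qed.

(** Segments avoid [0] and reach down to [1] for [a = 1] only; the root
    [e_a + e_b] contains [0] always, and [1] unless [a = 0]. *)
Lemma level_rankD b (J : pred nat) : (forall k, (1 < k)%N -> J k) ->
  level_rank segsD crossB crossrootD b.+1 J
    = ((if J 1 then b.+1 else b) +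
       (if J 0 then if J 1 then b.+1 else 1 else 0))%N.
Proof.
move=> J2; rewrite /level_rank count_cat !count_map; congr (_ + _)%N.
  have [J1|J'1] := boolP (J 1%N).
    rewrite (eq_in_count (a2 := predT)) ?count_predT ?size_iota // => a.
    rewrite mem_iota => a_gt0; apply/allP=> k _ /=.
    by case: k => [|[|k]]; [lia | rewrite J1 | rewrite J2].
  rewrite (eq_count (a2 := fun a => (1 < a)%N)) ?count_gt_iota //=; first by lia.
  by move=> a; apply: supported_seg_gap => // k /andP[/J2].
have [J0|J'0] := boolP (J 0%N); last first.
  apply/eqP; rewrite -leqn0 leqNgt -has_count; apply/hasPn=> a _.
  by apply/negP=> /allP/(_ 0%N (mem_head _ _)); rewrite (negPf J'0).
have [J1|J'1] := boolP (J 1%N).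
  rewrite (eq_count (a2 := predT)) ?count_predT ?size_iota // => a.
  by apply/allP=> -[|[|k]] _; [rewrite J0 | rewrite J1 | rewrite J2].
rewrite (eq_count (a2 := pred1 0%N)) => [|a].
  by rewrite count_uniq_mem ?iota_uniq // mem_iota.
apply/allP/eqP=> [/(_ 1%N)|-> [|[|k]] _ /=]; [ |by rewrite J0| |by rewrite J2].
  by rewrite mem_iota /= (negPf J'1) /crossrootD; lia.
by rewrite orbT.
Qed.

Lemma rankD m (J : pred nat) : (forall k, (1 < k)%N -> J k) ->
  rank segsD crossB crossrootD m.+2 J =
    (if J 0 && J 1 then 2 * 'C(m.+2, 2)
     else if J 0 || J 1 then 'C(m.+2, 2) else 'C(m.+1, 2))%N.
Proof.
move=> J2; elim: m => [|m IHm].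
  rewrite /rank !big_ord_recr big_ord0 /= level_rankD //=.
  by case: (J 0%N); case: (J 1%N).
rewrite /rank big_ord_recr /= -/(rank _ _ _ m.+2 _) IHm level_rankD //.
have bin2S k : 'C(k.+1, 2) = ('C(k, 2) + k)%N by rewrite binS bin1.
by rewrite !(bin2S m.+2) (bin2S m.+1); case: (J 0%N); case: (J 1%N) => /=; lia.
Qed.

(** Together with the vertices above the fork [0, 1], its four subsets give a
    path on [m] vertices, twice a path on [m + 1] vertices, and the whole
    diagram. *)
Lemma full_aboveD m : full_above segsD crossB crossrootD 2 m
  = (-1) ^+ m * ('X^('C(m.+1, 2)) - 2 * 'X^('C(m.+2, 2)) + 'X^(2 * 'C(m.+2, 2))%N).
Proof.
rewrite /full_above !big_set_max !big_set_ord0.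
rewrite !rankD; try by move=> k ->; rewrite orbT.
rewrite !(memn_lift, memn_max, memn_ge (n := 0)) //= !(cardsU1, max_notin_lift).
rewrite !(card_imset _ (@lift_inj _ _)) !(cardsU1, max_notin_lift).
rewrite !(card_imset _ (@lift_inj _ _)) !cards0 !add1n !addSn !add0n.
by rewrite !exprS; ring.
Qed.

Lemma subset_polyA m : \sum_(k < m.+1) subset_poly segsA crossA crossrootA k *
    ((-1) ^+ (m - k) * 'X^('C(m - k, 2))) = (-1) ^+ m * 'X^('C(m.+1, 2)).
Proof. by rewrite -full_aboveA -(subset_poly_recursion level_gapA). Qed.

Lemma subset_polyB m : \sum_(k < m.+1) subset_poly segsA crossB crossrootB k *
    ((-1) ^+ (m - k) * 'X^('C(m - k, 2))) = (-1) ^+ m * 'X^(m ^ 2).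
Proof. by rewrite -full_aboveB -(subset_poly_recursion level_gapB). Qed.

Lemma subset_polyD m : \sum_(k < m.+1) subset_poly segsD crossB crossrootD k.+2 *
    ((-1) ^+ (m - k) * 'X^('C(m - k, 2)))
  = (-1) ^+ m * ('X^('C(m.+1, 2)) - 2 * 'X^('C(m.+2, 2)) + 'X^(2 * 'C(m.+2, 2))%N).
Proof. by rewrite -full_aboveD -(subset_poly_recursion level_gapD). Qed.

Theorem theorem6p5
    (A : forall n : nat, finCoxeterSystem (@coxA n))
    (B : forall n : nat, finCoxeterSystem (@coxB n))
    (D : forall n : nat, finCoxeterSystem (@coxD n.+2)) :
  let Q : fps {poly int} := fun n => (-1) ^+ n * 'X^('C(n, 2)) in
  [/\ (fun n => mod_charpoly (A n))
        =1 fps_div (fun n => (-1) ^+ n * 'X^('C(n.+1, 2))) Q,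
      (fun n => mod_charpoly (B n))
        =1 fps_div (fun n => (-1) ^+ n * 'X^(n ^ 2)%N) Q
    & (fun n => if n is k.+2 then mod_charpoly (D k) else 0)
        =1 fps_div
             (fun n =>
                if (2 <= n)%N then
                  (-1) ^+ n * ('X^('C(n.-1, 2)) - 2 * 'X^('C(n, 2))
                               + 'X^(2 * 'C(n, 2))%N)
                else 0) Q].
Proof.
move=> Q; have Q0 : Q 0%N \is a GRing.unit by rewrite /Q expr0 bin0n expr0 mulr1 unitr1.
have charA n : mod_charpoly (A n) = subset_poly segsA crossA crossrootA n.
  apply: mod_charpoly_subset_poly (coxA_cartan n) (root_familyA n) => // b.
  exact: iota_uniq.
have charB n : mod_charpoly (B n) = subset_poly segsA crossB crossrootB n.
  by apply: mod_charpoly_subset_poly (coxB_cartan n) (root_familyB n) => // b;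
     apply: iota_uniq.
have charD n : mod_charpoly (D n) = subset_poly segsD crossB crossrootD n.+2.
  apply: mod_charpoly_subset_poly rev_ordK (coxD_cartan n) (root_familyD _) => // b;
    exact: iota_uniq.
split; apply/(fps_divP _ _ Q0) => n; rewrite /fps_mul.
- by rewrite -subset_polyA; apply: eq_bigr => k _; rewrite charA.
- by rewrite -subset_polyB; apply: eq_bigr => k _; rewrite charB.
case: n => [|[|n]].
- by rewrite big_ord1 mul0r.
- by rewrite !big_ord_recl big_ord0 !mul0r !addr0.
rewrite 2!big_ord_recl !mul0r !add0r /= !exprS !mulN1r opprK -subset_polyD.
by apply: eq_bigr => k _; rewrite charD.
Qed.
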